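(* Let $z=z[x;t]$ be defined by the differential equation $$\frac{dz}{dt}=L(t,x(t),{^C_aD^\alpha_t}x(t),z(t)),\quad t\in[a,b],\qquad z(a)=z_a,$$ where $x=(x_1,\ldots,x_n)$, ${^C_aD^\alpha_t}x=({^C_aD^{\alpha_1}_t}x_1,\ldots,{^C_aD^{\alpha_n}_t}x_n)$, $\alpha_j\in(0,1)$, $x\in C^1([a,b],\mathbb R^n)$ with ${^C_aD^\alpha_t}x\in C^1([a,b],\mathbb R^n)$, $L:[a,b]\times\mathbb R^{2n+1}\to\mathbb R$ is of class $C^1$, and, writing $[x,z](t):=(t,x(t),{^C_aD^\alpha_t}x(t),z(t))$ and $\lambda(t):=\exp\left(-\int_a^t \frac{\partial L}{\partial z}[x,z](\tau)d\tau\right)$, the functions ${_tD^{\alpha_j}_b}\left(\lambda(t)\frac{\partial L}{\partial {^C_aD^{\alpha_j}_t}x_j}[x,z](t)\right)$ exist and are continuous on $[a,b]$. Consider a one-parameter family of transformations $\bar{x}_j=h_j(t,x,s)$, $j=1,\ldots,n$, $s\in(-\varepsilon,\varepsilon)$, with $h_j$ of class $C^2$ and $h_j(t,x,0)=x_j$, so that $h_j(t,x,s)=x_j+s\xi_j(t,x)+o(s)$ with $\xi_j(t,x)=\frac{\partial}{\partial s}h_j(t,x,s)|_{s=0}$. Let $\theta(t)=\frac{d}{ds}\bar z[x+s\xi;t]\big|_{s=0}$, where $\bar z$ solves the same differential equation with the same initial value $z(a)=z_a$ and $x$ replaced by $\bar x$. Suppose the functional $z$ is invariant under this family, i.e. $\theta(t)\equiv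 0$. Then $$\sum_{j=1}^n\mathcal{D}^{\alpha_j}\left[\lambda(t)\frac{\partial L}{\partial {^C_aD^{\alpha_j}_t}x_j}[x,z](t),\xi_j(t,x)\right]=0,$$ where $\mathcal{D}^{\alpha}[f,g]:=f\cdot {^C_aD^{\alpha}_t}g- g\cdot{_tD^{\alpha}_b}f$, holds along the solutions of the generalized fractional Euler--Lagrange equations $$\lambda(t)\frac{\partial L}{\partial x_j}[x,z](t)+{_tD^{\alpha_j}_b}\left(\lambda(t)\frac{\partial L}{\partial {^C_aD^{\alpha_j}_t}x_j}[x,z](t)\right)=0,\quad j=1,\ldots,n.$$
   Context: ${^C_aD^\alpha_t}$ denotes the left Caputo fractional derivative and ${_tD^\alpha_b}$ the right Riemann--Liouville fractional derivative of order $\alpha\in(0,1)$: ${^C_aD^\alpha_t}x(t)=\frac{1}{\Gamma(1-\alpha)}\int_a^t(t-\tau)^{-\alpha}x'(\tau)d\tau$ and ${_tD^\alpha_b}x(t)=\frac{-1}{\Gamma(1-\alpha)}\frac{d}{dt}\int_t^b(\tau-t)^{-\alpha}x(\tau)d\tau$. *)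

(* Defs.v *)
From HB Require Import structures.
From mathcomp Require Import all_boot all_order all_algebra.
From mathcomp Require Import all_classical all_reals all_analysis.
Set Implicit Arguments. Unset Strict Implicit. Unset Printing Implicit Defensive.
Import Order.TTheory GRing.Theory Num.Theory.
Import numFieldNormedType.Exports.
Local Open Scope classical_set_scope.
Local Open Scope ring_scope.

Section FracDefs.
Variable R : realType.
Notation mu := (@lebesgue_measure R).

Definition Gamma (s : R) : R :=
  \int[mu]_(u in `]0, +oo[) (u `^ (s - 1) * expR (- u)).

Definition diffq (f : R -> R) (t : R) : R -> R := fun u => (f u - f t) / (u - t).

(* f has derivative l at t, relative to the interval [a,b]
   (one-sided at the end points). *)
Definition has_deriv_on (a b : R) (f : R -> R) (t l : R) : Prop :=
  diffq f t @ within `[a, b] (t^') --> l.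

Definition derivable_on (a b : R) (f : R -> R) (t : R) : Prop :=
  cvg (diffq f t @ within `[a, b] (t^')).

(* the derivative relative to [a,b] (meaningful when derivable_on holds) *)
Definition deriv_on (a b : R) (f : R -> R) (t : R) : R :=
  lim (diffq f t @ within `[a, b] (t^')).

Definition C1_on (a b : R) (f : R -> R) : Prop :=
  (forall t, a <= t <= b -> derivable_on a b f t) /\
  {within `[a, b], continuous (deriv_on a b f)}.

Definition caputo (a b al : R) (f : R -> R) (t : R) : R :=
  (Gamma (1 - al))^-1 *
  \int[mu]_(tau in `]a, t[) ((t - tau) `^ (- al) * deriv_on a b f tau).

Definition right_frac_int (b al : R) (f : R -> R) (s : R) : R :=
  \int[mu]_(tau in `]s, b[) ((tau - s) `^ (- al) * f tau).

Definition rl_right (a b al : R) (f : R -> R) (t : R) : R :=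
  - (Gamma (1 - al))^-1 * deriv_on a b (right_frac_int b al f) t.

Definition rl_right_exists (a b al : R) (f : R -> R) (t : R) : Prop :=
  derivable_on a b (right_frac_int b al f) t.

Definition Dpair (a b al : R) (f g : R -> R) (t : R) : R :=
  f t * caputo a b al g t - g t * rl_right a b al f t.

End FracDefs.

Section Smooth.
Variables (R : realType) (V : normedModType R).

Definition C1_open (U : set V) (f : V -> R) : Prop :=
  open U /\ (forall p, U p -> {for p, continuous f}) /\
  forall v : V, (forall p, U p -> derivable f p v) /\
                (forall p, U p -> {for p, continuous ('D_v f)}).

Definition C2_open (U : set V) (f : V -> R) : Prop :=
  C1_open U f /\ forall v : V, C1_open U ('D_v f).
End Smooth.

Definition erow (R : realType) (n : nat) (j : 'I_n) : 'rV[R]_n := delta_mx 0 j.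

(* Main.v *)
Require Import Defs.
From HB Require Import structures.
From mathcomp Require Import all_boot all_order all_algebra.
From mathcomp Require Import all_classical all_reals all_analysis.
From mathcomp Require Import measurable_realfun ring lra.
Import Order.TTheory GRing.Theory Num.Theory.
Import numFieldNormedType.Exports.
Local Open Scope classical_set_scope.
Local Open Scope ring_scope.

(** Put [y_j u = xi_j (u, x u)], [d_s = zbar s - z], and let [G] be the first variation
    [sum_j (dL/dx_j * y_j + dL/dDx_j * D^al y_j)]. By linearity of the Caputo derivative and
    strict differentiability of [L], near a point [t0] one has
    [d_s' = s G(t0) + dL/dz * d_s + o(|s| + |d_s|)]. Invariance says [d_s t = o(s)] for each
    single [t]; a local Gronwall estimate started at [t0] makes this uniform near [t0], and
    integrating over a short interval forces [G(t0) = 0]. The Euler--Lagrange equations turn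
    [lam * G] into the sum of the [Dpair]'s. Continuity of [D^al y_j] at [t0] comes from the
    Hoelder continuity of the fractional integral of a bounded function. *)

(** * Derivatives relative to an interval *)

(** The usual argument differentiates the equation of [zbar s] in [s] and exchanges the two
    derivatives, which gives a linear equation for theta. Pointwise smallness at two times is
    enough: if [d_s] is [o(s)] at [t0] and at a nearby [t1], its increment, close to
    [s * G(t0) * (t1 - t0)], is [o(s)] too. For this [t1] has to be fixed before [s], on a window
    whose length depends only on the precision wanted. Two side issues shape the lemmas. [C1_open]
    speaks of one direction at a time, so expansions in all variables are rebuilt from mean value
    estimates, and the base point must be free to move with [t]. And theta compares [zbar s] with
    [zbar 0], so [zbar 0 = z] has to come from uniqueness for the differential equation. *)

Section DerivOn.
Context {R : realType}.
Implicit Types (a b t l : R) (f g : R -> R).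

Definition cont_on (a b : R) (f : R -> R) (t : R) : Prop :=
  forall e : R, 0 < e -> exists2 d : R, 0 < d & forall u : R, a <= u <= b -> `|u - t| < d ->
    `|f u - f t| < e.

Lemma within_dnbhs_near a b t (P : R -> Prop) :
  (\forall u \near within `[a, b] (t^'), P u) <->
  exists2 d : R, 0 < d & forall u : R, a <= u <= b -> u != t -> `|u - t| < d -> P u.
Proof.
split.
- move=> [d /= d0 H]; exists d => // u uab ut utd.
  by apply: H => //=; rewrite ?in_itv//= distrC.
- move=> [d d0 H]; exists d => // u /=; rewrite distrC => ud ut uab.
  by apply: H => //; move: uab; rewrite /= in_itv.
Qed.

(** Clearing the denominator removes the puncture: at [u = t] both sides vanish, so later estimates
    need no case [u != t]. *)
Lemma has_deriv_onP a b f t l :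
  has_deriv_on a b f t l <->
  forall e : R, 0 < e -> exists2 d : R, 0 < d & forall u : R, a <= u <= b -> `|u - t| < d ->
    `|f u - f t - l * (u - t)| <= e * `|u - t|.
Proof.
split.
- move=> /cvgrPdist_le H e /H/within_dnbhs_near[d d0 {}H]; exists d => // u uab utd.
  have [->|ut] := eqVneq u t; first by rewrite !subrr mulr0 subr0 normr0 mulr0.
  have ut0 : u - t != 0 by rewrite subr_eq0.
  have := H u uab ut utd; rewrite /diffq => {}H.
  have -> : f u - f t - l * (u - t) = - (l - (f u - f t) / (u - t)) * (u - t) by field.
  by rewrite normrM normrN ler_wpM2r.
- move=> H; apply/cvgrPdist_le => e e0; apply/within_dnbhs_near.
  have [d d0 {}H] := H e e0; exists d => // u uab ut utd.
  have ut0 : u - t != 0 by rewrite subr_eq0.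
  have := H u uab utd; rewrite /diffq => {}H.
  rewrite -(ler_pM2r (x := `|u - t|)) ?normr_gt0// -normrM -normrN.
  by have -> : - ((l - (f u - f t) / (u - t)) * (u - t)) = f u - f t - l * (u - t) by field.
Qed.

(** This is what makes the limit in [deriv_on] unique. Since [a < b], there is room on at least one
    side of [t]: to the right if [t < b], to the left otherwise. *)
Lemma within_dnbhs_proper a b t : a < b -> a <= t <= b ->
  ProperFilter (within `[a, b] (t^')).
Proof.
move=> ab /andP[ta tb]; apply: Build_ProperFilter_ex => A /within_dnbhs_near[d d0 H].
have [tb'|bt] := ltP t b.
- have m0 : 0 < Num.min (d / 2) (b - t) by rewrite lt_min divr_gt0//= subr_gt0.
  have m1 : Num.min (d / 2) (b - t) <= d / 2 by rewrite ge_min lexx.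
  have m2 : Num.min (d / 2) (b - t) <= b - t by rewrite ge_min lexx orbT.
  exists (t + Num.min (d / 2) (b - t)); apply: H.
  + by apply/andP; split; lra.
  + by rewrite gt_eqF// ltrDl.
  + rewrite addrAC subrr add0r gtr0_norm//; lra.
- have m0 : 0 < Num.min (d / 2) (b - a) by rewrite lt_min divr_gt0//= subr_gt0.
  have m1 : Num.min (d / 2) (b - a) <= d / 2 by rewrite ge_min lexx.
  have m2 : Num.min (d / 2) (b - a) <= b - a by rewrite ge_min lexx orbT.
  exists (t - Num.min (d / 2) (b - a)); apply: H.
  + by apply/andP; split; lra.
  + by rewrite lt_eqF// ltrBlDr ltrDl.
  + rewrite addrAC subrr add0r normrN gtr0_norm//; lra.
Qed.

Lemma has_deriv_onE a b f t l : a < b -> a <= t <= b ->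
  has_deriv_on a b f t l -> deriv_on a b f t = l.
Proof.
move=> ab tab H; have := within_dnbhs_proper _ _ _ ab tab => ?.
exact: (cvg_lim _ H).
Qed.

Lemma has_deriv_onD a b f g t l m :
  has_deriv_on a b f t l -> has_deriv_on a b g t m ->
  has_deriv_on a b (fun u => f u + g u) t (l + m).
Proof.
move=> /has_deriv_onP F /has_deriv_onP G; apply/has_deriv_onP => e e0.
have e20 : 0 < e / 2 by lra.
have [d d0 {}F] := F _ e20; have [d' d0' {}G] := G _ e20.
exists (Num.min d d'); first by rewrite lt_min d0.
move=> u uab; rewrite lt_min => /andP[/(F u uab) {}F /(G u uab) {}G].
have -> : f u + g u - (f t + g t) - (l + m) * (u - t) =
  (f u - f t - l * (u - t)) + (g u - g t - m * (u - t)) by ring.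
by rewrite (le_trans (ler_normD _ _))//; lra.
Qed.

Lemma has_deriv_onZ a b f t l (c : R) :
  has_deriv_on a b f t l -> has_deriv_on a b (fun u => c * f u) t (c * l).
Proof.
move=> /has_deriv_onP F; apply/has_deriv_onP => e e0.
(* The [+ 1] keeps the divisor positive when [c = 0]. *)
have c0 : 0 < `|c| + 1 by rewrite ltr_wpDl.
have [d d0 {}F] := F _ (divr_gt0 e0 c0).
exists d => // u uab /(F u uab) {}F.
have -> : c * f u - c * f t - c * l * (u - t) = c * (f u - f t - l * (u - t)) by ring.
rewrite normrM (le_trans (ler_wpM2l _ F))// mulrA ler_wpM2r//.
by rewrite mulrCA ger_pMr// ler_pdivrMr// mul1r lerDl.
Qed.

Lemma has_deriv_on_cont a b f t l : has_deriv_on a b f t l -> cont_on a b f t.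
Proof.
move=> /has_deriv_onP/(_ 1 ltr01)[d d0 H] e e0.
have l0 : 0 < `|l| + 2 by rewrite ltr_wpDl.
exists (Num.min d (e / (`|l| + 2))); first by rewrite lt_min d0 divr_gt0.
move=> u uab; rewrite lt_min => /andP[/(H u uab) {}H].
rewrite ltr_pdivlMr// => He.
have -> : f u - f t = (f u - f t - l * (u - t)) + l * (u - t) by ring.
rewrite (le_lt_trans (ler_normD _ _))// (le_lt_trans _ He)//.
rewrite [`|l * _|]normrM; have := normr_ge0 (u - t); nra.
Qed.

Lemma has_deriv_on_continuous a b f f' :
  (forall t : R, a <= t <= b -> has_deriv_on a b f t (f' t)) ->
  {within `[a, b], continuous f}.
Proof.
move=> H; apply/subspace_continuousP => t /=; rewrite in_itv/= => tab.
apply/cvgrPdist_lt => e e0.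
have [d d0 {}H] := has_deriv_on_cont _ _ _ _ _ (H t tab) e e0.
exists d => // u /= tu; rewrite in_itv/= => uab; rewrite distrC.
by apply: H => //; rewrite distrC.
Qed.

Lemma within_itv_continuousP a b f :
  {within `[a, b], continuous f} <->
  forall t : R, a <= t <= b -> cont_on a b f t.
Proof.
split.
- move=> /subspace_continuousP H t tab e e0.
  have /H/cvgrPdist_lt/(_ e e0) : [set` `[a, b]] t by rewrite /= in_itv.
  move=> [d /= d0 {}H]; exists d => // u uab ut; rewrite distrC.
  by apply: H => //=; rewrite 1?distrC// in_itv.
- move=> H; apply/subspace_continuousP => t /=; rewrite in_itv/= => tab.
  apply/cvgrPdist_lt => e e0; have [d d0 {}H] := H t tab e e0.
  exists d => // u /= tu; rewrite in_itv/= => uab; rewrite distrC.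
  by apply: H => //; rewrite distrC.
Qed.

Lemma has_deriv_on_is_derive a b f t l : a < t < b ->
  has_deriv_on a b f t l -> is_derive t 1 f l.
Proof.
move=> /andP[ta tb] /has_deriv_onP H.
have C : (fun h => h^-1 *: (f (h *: 1 + t) - f t)) @ 0^' --> l.
  apply/cvgrPdist_le => e e0; have [d d0 {}H] := H e e0.
  exists (Num.min d (Num.min (t - a) (b - t))).
    by rewrite /= !lt_min d0 !subr_gt0 ta.
  move=> u /=; rewrite sub0r normrN !lt_min => /and3P[ud ua ub] u0.
  have := H (u + t); rewrite addrK => {}H.
  have /H/(_ ud) {}H : a <= u + t <= b.
    by move: ua ub; rewrite !ltr_norml => /andP[? ?] /andP[? ?]; apply/andP; split; lra.
  rewrite -(ler_pM2r (x := `|u|)) ?normr_gt0// -normrM -[leLHS]normrN.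
  rewrite /GRing.scale/= mulr1.
  by have -> : - ((l - u^-1 * (f (u + t) - f t)) * u) = f (u + t) - f t - l * u by field.
by apply: DeriveDef; [apply: cvgP C | apply: cvg_lim C].
Qed.

(* Stated with a free slope [l] so that it bounds both increments ([l = 0]) and
   deviations from a linear function. *)
Lemma mean_value_le a b f f' (l K t1 t2 : R) :
  a <= t1 -> t1 <= t2 -> t2 <= b ->
  (forall t : R, a <= t <= b -> has_deriv_on a b f t (f' t)) ->
  (forall t, t1 < t < t2 -> `|f' t - l| <= K) ->
  `|f t2 - f t1 - l * (t2 - t1)| <= K * (t2 - t1).
Proof.
move=> at1 t12 t2b H K1.
have [->|t12n] := eqVneq t1 t2; first by rewrite !subrr !mulr0 subr0 normr0.
have {}t12 : t1 < t2 by rewrite lt_neqAle t12n.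
have [||c] := @MVT R f f' t1 t2 t12.
- move=> t; rewrite in_itv/= => /andP[? ?].
  apply: (@has_deriv_on_is_derive a b); first by apply/andP; split; lra.
  by apply: H; apply/andP; split; lra.
- apply: (@continuous_subspaceW _ _ _ `[a, b]).
    by move=> u /=; rewrite !in_itv/= => /andP[? ?]; apply/andP; split; lra.
  exact: has_deriv_on_continuous H.
rewrite in_itv/= => /K1 cK ->; rewrite -mulrBl normrM (@gtr0_norm _ (t2 - t1)) ?subr_gt0//.
by rewrite ler_wpM2r// subr_ge0 ltW.
Qed.

(** The bound on [f'] is only asked at points strictly closer to [t1] than [t2] is; a first-exit
    argument can supply no more than that. *)
Lemma mean_value_dist_le a b f f' (l K t1 t2 : R) :
  a <= t1 <= b -> a <= t2 <= b ->
  (forall t : R, a <= t <= b -> has_deriv_on a b f t (f' t)) ->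
  (forall t : R, a <= t <= b -> `|t - t1| < `|t2 - t1| -> `|f' t - l| <= K) ->
  `|f t2 - f t1 - l * (t2 - t1)| <= K * `|t2 - t1|.
Proof.
move=> /andP[? ?] /andP[? ?] H HK; have [t12|t21] := leP t1 t2.
- have t210 : 0 <= t2 - t1 by lra.
  rewrite (ger0_norm t210); apply: (@mean_value_le a b f f') => // t /andP[? ?].
  apply: HK; first by apply/andP; split; lra.
  by rewrite !ger0_norm; lra.
- have t120 : t2 - t1 < 0 by lra.
  have -> : f t2 - f t1 - l * (t2 - t1) = - (f t1 - f t2 - l * (t1 - t2)) by ring.
  rewrite normrN (ltr0_norm t120) opprB; apply: (@mean_value_le a b f f') => //; first lra.
  move=> t /andP[? ?]; apply: HK; first by apply/andP; split; lra.
  by rewrite !ltr0_norm; lra.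
Qed.

End DerivOn.

(** * Local Gronwall estimates *)

Section Gronwall.
Context {R : realType}.
Implicit Types (a b t : R).

Lemma closed_superlevel a b (f : R -> R) (c : R) :
  {within `[a, b], continuous f} -> closed [set t | a <= t <= b /\ c <= f t].
Proof.
move=> /within_itv_continuousP cf t clt.
have tab : a <= t <= b.
  have : [set` `[a, b]] t.
    have cab : closed [set` `[a, b]] by exact: (@interval_closed R).
    apply: cab => A /clt[u [[uab _] Au]].
    by exists u; split => //=; rewrite in_itv.
  by rewrite /= in_itv.
split => //; rewrite leNgt; apply/negP => ftc.
have fc0 : 0 < c - f t by rewrite subr_gt0.
have [d d0 cfd] := cf t tab _ fc0.
have /clt[u [[uab cfu] tu]] : nbhs t (ball t d) by exact: nbhsx_ballx.
have := cfd u uab; rewrite distrC => /(_ tu); rewrite ltr_norml => /andP[]; lra.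
Qed.

(* Bootstrapping: at the point closest to [t0] where [`|d|] exceeds the claimed bound, the
   mean value theorem gives a contradiction because [M * r <= 1/2]. *)
Lemma local_gronwall a b (d d' : R -> R) (t0 M k eta rho r : R) :
  a <= t0 <= b ->
  (forall t : R, a <= t <= b -> has_deriv_on a b d t (d' t)) ->
  0 <= M -> 0 <= k -> M * r <= 2^-1 -> 2 * eta + k < rho -> `|d t0| <= eta ->
  (forall t : R, a <= t <= b -> `|t - t0| < r -> `|d t| < rho ->
    `|d' t| <= M * (k + `|d t|)) ->
  forall t : R, a <= t <= b -> `|t - t0| < r -> `|d t| <= 2 * eta + k.
Proof.
move=> t0ab dd' M0 k0 Mr B_rho deta d'M t1 t1ab t1r; rewrite leNgt; apply/negP => Bd.
(* A level above the claimed bound but below [rho], and already reached at [t1]: as long as [|d|]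
   stays below [B], the differential inequality applies. *)
pose B := Num.min `|d t1| ((2 * eta + k + rho) / 2).
have BB : 2 * eta + k < B by rewrite lt_min Bd/=; lra.
have Brho : B < rho by rewrite gt_min; apply/orP; right; lra.
have Bt1 : B <= `|d t1| by rewrite ge_min lexx.
have cd : {within `[a, b], continuous (fun t => `|d t|)}.
  apply/within_itv_continuousP => t tab e e0.
  have /within_itv_continuousP/(_ t tab e e0)[dl dl0 H] := has_deriv_on_continuous _ _ _ _ dd'.
  by exists dl => // u uab /(H u uab); apply: le_lt_trans; exact: ler_dist_dist.
pose S := [set t | a <= t <= b /\ B <= `|d t|].
have S0 : S !=set0 by exists t1.
have cS : compact S.
  apply: (@subclosed_compact _ _ `[a, b]); last 2 first.
  - exact: segment_compact.
  - by move=> t /= [tab _]; rewrite in_itv.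
  - exact: closed_superlevel.
have cdist : {within S, continuous (fun t => `|t - t0|)}.
  apply: continuous_subspaceT => t; apply: cvg_norm.
  by apply: cvgB => //; exact: cvg_cst.
have [t2] := compact_EVT_min S0 cS cdist.
rewrite inE => -[t2ab Bt2] mint2.
have t2t1 : `|t2 - t0| <= `|t1 - t0| by apply: mint2; rewrite inE.
have := @mean_value_dist_le R a b d d' 0 (M * (k + B)) t0 t2 t0ab t2ab dd'.
have H : forall t : R, a <= t <= b -> `|t - t0| < `|t2 - t0| -> `|d' t - 0| <= M * (k + B).
  move=> t tab tt2; rewrite subr0.
  have dtB : `|d t| < B.
    rewrite ltNge; apply/negP => Bdt.
    by have := mint2 t; rewrite inE leNgt tt2 => /(_ (conj tab Bdt)).
  rewrite (le_trans (d'M t tab _ _))//; [|exact: lt_trans Brho|].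
  - by rewrite (lt_le_trans tt2)// (le_trans t2t1)// ltW.
  - by rewrite ler_wpM2l// lerD2l ltW.
move=> /(_ H); rewrite mul0r subr0 => {}H.
have kB : 0 <= k + B.
  by have := normr_ge0 (d t0); lra.
have : M * (k + B) * `|t2 - t0| <= 2^-1 * (k + B).
  rewrite mulrAC ler_wpM2r// (le_trans _ Mr)// ler_wpM2l//.
  by rewrite (le_trans t2t1)// ltW.
(* Altogether [B <= |d t2| <= (k + B) / 2 + eta], hence [B <= 2 * eta + k], against [BB]. The form
   of the bound comes from here. *)
have : `|d t2| <= `|d t2 - d t0| + `|d t0|.
  by have := ler_normD (d t2 - d t0) (d t0); rewrite subrK.
lra.
Qed.

(** Connectedness of [[a, b]]: the solutions agree on a nonempty, closed and relatively open subset.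
    For openness, [local_gronwall] is used with [eta = k = 0], where its bound is [0]. A Lipschitz
    constant near [(t0, z1 t0)] suffices, because at a point of agreement both solutions start from
    there. *)
Lemma ode_unique a b (F : R -> R -> R) (z1 z2 : R -> R) :
  a < b -> z1 a = z2 a ->
  (forall t : R, a <= t <= b -> has_deriv_on a b z1 t (F t (z1 t))) ->
  (forall t : R, a <= t <= b -> has_deriv_on a b z2 t (F t (z2 t))) ->
  (forall t0, a <= t0 <= b -> exists M dl : R, [/\ 0 <= M, 0 < dl &
    forall t y1 y2, a <= t <= b -> `|t - t0| < dl -> `|y1 - z1 t0| < dl ->
      `|y2 - z1 t0| < dl -> `|F t y1 - F t y2| <= M * `|y1 - y2|]) ->
  forall t : R, a <= t <= b -> z1 t = z2 t.
Proof.
move=> ab za z1F z2F FL.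
pose d t := z1 t + -1 * z2 t.
pose d' t := F t (z1 t) + -1 * F t (z2 t).
have dd' t : a <= t <= b -> has_deriv_on a b d t (d' t).
  by move=> tab; apply: has_deriv_onD; [exact: z1F|apply: has_deriv_onZ; exact: z2F].
(* The zero set of [d], written as a superlevel set of [- |d|] so that [closed_superlevel]
   applies. *)
pose S := [set t | a <= t <= b /\ 0 <= - `|d t|].
have Sd t : S t <-> a <= t <= b /\ d t = 0.
  split=> [[tab]|[tab dt]]; last by split => //; rewrite dt normr0 oppr0.
  by rewrite oppr_ge0 normr_le0 => /eqP.
have Sz t : S t -> z1 t = z2 t by move=> /Sd[_]; rewrite /d; lra.
suff SE : S = [set` `[a, b]] by move=> t tab; apply: Sz; rewrite SE /= in_itv.
apply: (@segment_connected R a b).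
- by exists a; apply/Sd; rewrite lexx ltW//; split => //; rewrite /d za; lra.
(* Membership is vacuous outside [[a, b]], so this interior in [R] cuts out the relative interior of
   the zero set. *)
- exists ([set t | a <= t <= b -> d t = 0]°); first exact: open_interior.
  apply/seteqP; split => t.
  + move=> /Sd[t0ab dt0]; split; first by rewrite /= in_itv.
    have [M [dl [M0 dl0 HM]]] := FL t t0ab.
    have [r1 r10 H1] := has_deriv_on_cont _ _ _ _ _ (z1F t t0ab) _ dl0.
    have [r2 r20 H2] := has_deriv_on_cont _ _ _ _ _ (z2F t t0ab) _ dl0.
    have M10 : 0 < 2 * (M + 1) by lra.
    pose r := Num.min (Num.min dl (2 * (M + 1))^-1) (Num.min r1 r2).
    have r0 : 0 < r by rewrite !lt_min dl0 r10 r20 invr_gt0 M10.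
    exists r => // u ut uab; apply/eqP; rewrite -normr_le0.
    have -> : 0 = 2 * 0 + 0 :> R by lra.
    have Mr : M * r <= 2^-1.
      have : r <= (2 * (M + 1))^-1 by rewrite !ge_min lexx orbT.
      move=> /(ler_wpM2l M0) /le_trans; apply.
      by rewrite ler_pdivrMr//; lra.
    apply: (@local_gronwall a b d d' t M 0 0 1 r) => //; [by rewrite dt0 normr0| |].
    * move=> v vab; rewrite !lt_min => /andP[/andP[v1 _] /andP[v2 v3]] _.
      rewrite add0r /d' /d !mulN1r; apply: HM => //; first exact: H1.
      have -> : z1 t = z2 t by move: dt0; rewrite /d; lra.
      exact: H2.
    * by rewrite distrC.
  + move=> [/=]; rewrite in_itv/= => tab /interior_subset/(_ tab) dt.
    by apply/Sd.
- exists S; last by apply/seteqP; split => [t [tab ?]|t []//]; split => //=; rewrite in_itv.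
  apply: closed_superlevel; apply/within_itv_continuousP => t tab e e0.
  have /within_itv_continuousP/(_ t tab e e0)[dl dl0 H] := has_deriv_on_continuous _ _ _ _ dd'.
  exists dl => // u uab /(H u uab); apply: le_lt_trans.
  by rewrite -opprD normrN; exact: ler_dist_dist.
Qed.

(** The size of [d] is found in two rounds. Gronwall gives [|d| <= 3 * s], which is only [O(s)];
    integrating the resulting bound on [d'] over a window of length about [e / (8 * M)] improves it
    to [2 * e * s]. Only then is [A * |d|] an error of order [e * s], and the slope deviates from
    [s * G] by at most [(1 + 2 * A) * e * s]. *)
Lemma local_linear_growth a b (d d' : R -> R) (t0 G A e s dl r : R) :
  a <= t0 <= b -> 0 < s -> 0 < e -> e < 1 -> 0 <= A -> 3 * s < dl ->
  8 * (`|G| + A + 1) * r <= e ->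
  (forall t : R, a <= t <= b -> has_deriv_on a b d t (d' t)) ->
  `|d t0| <= e * s ->
  (forall t : R, a <= t <= b -> `|t - t0| < r -> `|d t| < dl ->
     `|d' t - s * G| <= e * s + A * `|d t|) ->
  forall t : R, a <= t <= b -> `|t - t0| < r ->
    `|d t - d t0 - s * G * (t - t0)| <= (1 + 2 * A) * e * s * `|t - t0|.
Proof.
move=> t0ab s0 e0 e1 A0 sdl Mr dd' dt0 d's.
have G0 := normr_ge0 G; have ns : `|s| = s by rewrite gtr0_norm.
have [M ME] : exists M, M = `|G| + A + 1 by exists (`|G| + A + 1).
have M1 : 1 <= M by lra.
have M0 : 0 <= M by lra.
rewrite -ME in Mr.
have es : e * s < s by rewrite gtr_pMl.
have d'bnd t : a <= t <= b -> `|t - t0| < r -> `|d t| < dl ->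
    `|d' t| <= M * (s + `|d t|).
  move=> tab tr dsl; have := d's t tab tr dsl.
  have : `|d' t| <= `|d' t - s * G| + s * `|G|.
    by have := ler_normD (d' t - s * G) (s * G); rewrite subrK normrM ns.
  have := normr_ge0 (d t); rewrite ME; nra.
have d3 t : a <= t <= b -> `|t - t0| < r -> `|d t| <= 3 * s.
  have Mr2 : M * r <= 2^-1 by lra.
  (* [local_gronwall] is used with [eta = e * s], [k = s] and [rho = dl]; its bound is below [3 * s]
     because [e < 1]. *)
  have B : 2 * (e * s) + s < dl by lra.
  move=> tab tr; apply: (@le_trans _ _ (2 * (e * s) + s)); last by lra.
  exact: (@local_gronwall a b d d' t0 M s (e * s) dl r _ _ _ (ltW s0)).
have d2 t : a <= t <= b -> `|t - t0| < r -> `|d t| <= 2 * e * s.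
  move=> tab tr.
  have := @mean_value_dist_le R a b d d' 0 (M * (4 * s)) t0 t t0ab tab dd'.
  have H u : a <= u <= b -> `|u - t0| < `|t - t0| -> `|d' u - 0| <= M * (4 * s).
    move=> uab utt; have ur := lt_trans utt tr; rewrite subr0.
    have d3u := d3 u uab ur.
    rewrite (le_trans (d'bnd u uab ur (le_lt_trans d3u sdl)))// ler_wpM2l//.
    by move: d3u; clear; lra.
  move=> /(_ H); rewrite mul0r subr0 => {}H.
  have Mt : 8 * M * `|t - t0| <= e.
    by rewrite (le_trans _ Mr)// ler_wpM2l ?mulr_ge0//; exact: ltW.
  have dtt : `|d t| <= `|d t - d t0| + `|d t0|.
    by have := ler_normD (d t - d t0) (d t0); rewrite subrK.
  have := ler_wpM2l (ltW s0) Mt; have := mulr_gt0 e0 s0.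
  by move: H dtt dt0; clear; lra.
move=> t tab tr; apply: (mean_value_dist_le a b d d') => // u uab utt.
have ur := lt_trans utt tr.
have d2u := d2 u uab ur; have d3u := le_lt_trans (d3 u uab ur) sdl.
rewrite (le_trans (d's u uab ur d3u))//.
by have := ler_wpM2l A0 d2u; clear; lra.
Qed.

Lemma linearized_slope_eq0 a b (eps : R) (d d' : R -> R -> R) (t0 G A : R) :
  a < b -> a <= t0 <= b -> 0 < eps -> 0 <= A ->
  (forall s : R, - eps < s < eps -> forall t : R, a <= t <= b ->
     has_deriv_on a b (d s) t (d' s t)) ->
  (forall e : R, 0 < e -> exists2 dl : R, 0 < dl & forall s t : R, a <= t <= b ->
     `|t - t0| < dl -> `|s| < dl -> `|d s t| < dl ->
     `|d' s t - s * G| <= e * `|s| + A * `|d s t|) ->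
  (forall t : R, a <= t <= b -> forall eta : R, 0 < eta -> exists2 dl : R, 0 < dl &
     forall s : R, `|s| < dl -> `|d s t| <= eta * `|s|) ->
  G = 0.
Proof.
move=> ab t0ab eps0 A0 dd' dlin d_o.
(* The factor [1 + 2 * A] comes from [local_linear_growth]; each of the two endpoints adds one more
   [e]. *)
suff H (e : R) : 0 < e -> e < 1 -> `|G| <= (3 + 2 * A) * e.
  apply/eqP; rewrite -normr_le0; apply/ler_addgt0Pl => e e0; rewrite addr0.
  have A30 : 0 < 3 + 2 * A by lra.
  have e'0 : 0 < Num.min (e / (3 + 2 * A)) 2^-1 by rewrite lt_min divr_gt0//= invr_gt0.
  have e'1 : Num.min (e / (3 + 2 * A)) 2^-1 < 1 by rewrite gt_min; apply/orP; right; lra.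
  rewrite (le_trans (H _ e'0 e'1))// mulrC -ler_pdivlMr//.
  by rewrite ge_min lexx.
move=> e0 e1.
have [dl dl0 {}dlin] := dlin e e0.
pose M := `|G| + A + 1.
have G0 := normr_ge0 G.
have ME : M = `|G| + A + 1 by [].
clearbody M.
have M1 : 1 <= M by lra.
have M0 : 0 < 8 * M by lra.
pose r := Num.min dl (e / (8 * M)).
have r0 : 0 < r by rewrite lt_min dl0 divr_gt0.
have rdl : r <= dl by rewrite ge_min lexx.
have Mr : 8 * M * r <= e by rewrite mulrC -ler_pdivlMr// ge_min lexx orbT.
clearbody r.
have [t1 [t1ab t1t0 t1r]] : exists t1 : R, [/\ a <= t1 <= b, t1 != t0 & `|t1 - t0| < r].
  have ? := within_dnbhs_proper _ _ _ ab t0ab.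
  apply: (@filter_ex _ (within `[a, b] (t0^')) _
    [set u | [/\ a <= u <= b, u != t0 & `|u - t0| < r]]).
  by apply/within_dnbhs_near; exists r.
have t1t00 : 0 < `|t1 - t0| by rewrite normr_gt0 subr_eq0.
have t1t01 : `|t1 - t0| < 1 by nra.
(* The precision is proportional to [|t1 - t0|], since it competes with the increment
   [s * G * (t1 - t0)]. *)
have eta0 : 0 < e * `|t1 - t0| by rewrite mulr_gt0.
have [d0 d00 H0] := d_o t0 t0ab _ eta0.
have [d1 d10 H1] := d_o t1 t1ab _ eta0.
(* [s] is chosen last, with [t0] and [t1] fixed, so smallness at these two times needs no uniformity
   in [t]. The bound [dl / 4] ensures [3 * s < dl]. *)
pose s := (Num.min (Num.min d0 d1) (Num.min (dl / 4) eps)) / 2.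
have s0 : 0 < s by rewrite divr_gt0// !lt_min d00 d10 eps0 divr_gt0.
have sE : s * 2 = Num.min (Num.min d0 d1) (Num.min (dl / 4) eps) by rewrite /s; field.
have [sd0 sd1 sdl seps] : [/\ s * 2 <= d0, s * 2 <= d1, s * 2 <= dl / 4 & s * 2 <= eps].
  by rewrite sE; split; rewrite !ge_min lexx ?orbT.
clearbody s; clear sE.
have ns : `|s| = s by rewrite gtr0_norm.
have {}H0 : `|d s t0| <= e * `|t1 - t0| * s.
  by rewrite -{2}ns; apply: H0; rewrite ns (lt_le_trans _ sd0)// ltr_pMr// ltr1n.
have {}H1 : `|d s t1| <= e * `|t1 - t0| * s.
  by rewrite -{2}ns; apply: H1; rewrite ns (lt_le_trans _ sd1)// ltr_pMr// ltr1n.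
have H0' : `|d s t0| <= e * s.
  by rewrite (le_trans H0)// mulrAC ger_pMr ?mulr_gt0// ltW.
have H : `|d s t1 - d s t0 - s * G * (t1 - t0)| <= (1 + 2 * A) * e * s * `|t1 - t0|.
  apply: (@local_linear_growth a b (d s) (d' s) t0 G A e s dl r) => //.
  - by move: s0 sdl; clear; lra.
  - by rewrite -ME.
  - by apply: dd'; move: s0 seps; clear => ? ?; apply/andP; split; lra.
  - move=> t tab tr dsl; rewrite -{3}ns; apply: dlin => //; first exact: lt_le_trans rdl.
    by rewrite ns; move: s0 sdl; clear; lra.
have : s * `|G| * `|t1 - t0| <= `|d s t1 - d s t0 - s * G * (t1 - t0)| + (`|d s t1| + `|d s t0|).
  rewrite -{1}ns -!normrM; set w := _ * (t1 - t0).
  have := ler_normB (d s t1 - d s t0) (d s t1 - d s t0 - w).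
  by rewrite subKr addrC => /le_trans; apply; rewrite lerD2l ler_normB.
move=> H2.
have : (s * `|t1 - t0|) * `|G| <= (s * `|t1 - t0|) * ((3 + 2 * A) * e) by nra.
by rewrite ler_pM2l// mulr_gt0.
Qed.

End Gronwall.

(** * Strict differentiability and curves *)

Lemma fin_radius (R : realType) (I : finType) (P : I -> R -> Prop) :
  (forall i d d', 0 < d' -> d' <= d -> P i d -> P i d') ->
  (forall i, exists2 d : R, 0 < d & P i d) -> exists2 d : R, 0 < d & forall i, P i d.
Proof.
move=> Pmono exd; pose d i := s2val (cid2 (exd i)).
have d0 i : 0 < d i by rewrite /d; case: cid2.
have Pd i : P i (d i) by rewrite /d; case: cid2.
(* The seed [1] also covers an empty index type. *)
have m0 : 0 < \big[Num.min/1]_i d i by apply/lt_bigmin.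
exists (\big[Num.min/1]_i d i) => // i; apply: Pmono (Pd i) => //.
exact: bigmin_le_cond.
Qed.

Section StrictDifferentiability.
Context {R : realType} {V : normedModType R}.
Implicit Types (U : set V) (f : V -> R) (p q v : V).

Lemma is_derive_line f q v (t : R) : derivable f (q + t *: v) v ->
  is_derive t 1 (fun u => f (q + u *: v)) ('D_v f (q + t *: v)).
Proof.
move=> df.
have E : (fun h => h^-1 *: (((fun u => f (q + u *: v)) \o shift t) (h *: (1 : R)) -
                            f (q + t *: v))) =
         (fun h => h^-1 *: ((f \o shift (q + t *: v)) (h *: v) - f (q + t *: v))).
  apply/funext => h /=; congr (_ *: (f _ - _)).
  by rewrite scalerDl /GRing.scale/= mulr1 addrCA.
by apply: DeriveDef; rewrite /derivable /derive ?E.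
Qed.

Lemma line_mean_value f q v (c : R) :
  (forall t, `|t| <= `|c| -> derivable f (q + t *: v) v) ->
  exists2 t, `|t| <= `|c| & f (q + c *: v) - f q = c * 'D_v f (q + t *: v).
Proof.
move=> df.
have H (u w : R) : u <= w -> (forall t, u <= t <= w -> `|t| <= `|c|) ->
    exists2 t, `|t| <= `|c| & f (q + w *: v) - f (q + u *: v) = 'D_v f (q + t *: v) * (w - u).
  move=> uw uwc.
  have [|| t + ->] := @MVT_segment R (fun u => f (q + u *: v))
    (fun t => 'D_v f (q + t *: v)) u w uw.
  - move=> t; rewrite in_itv/= => /andP[ut tw]; apply: is_derive_line.
    by apply/df/uwc; rewrite !ltW.
  - apply: derivable_within_continuous => t; rewrite in_itv/= => /uwc/df df'.
    by have [] := is_derive_line _ _ _ _ df'.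
  - by rewrite in_itv/= => tuw; exists t => //; exact: uwc.
have [c0|c0] := leP 0 c.
- have [|t tc] := H 0 c c0.
    by move=> t /andP[t0 tc]; rewrite !ger0_norm.
  by rewrite scale0r addr0 subr0 mulrC => ->; exists t.
- have [|t tc] := H c 0 (ltW c0).
    by move=> t /andP[ct t0]; rewrite (ltr0_norm c0) ler0_norm// lerN2.
  rewrite scale0r addr0 sub0r mulrN => E; exists t => //.
  by rewrite -opprB E opprK mulrC.
Qed.

(** Both [q] and [q + c *: v] may vary near [p0]: the segment between them stays in a ball where
    ['D_v f] is within [e] of its value at [p0], and the mean value theorem is applied along it. *)
Lemma C1_open_strict1 U f p0 v : C1_open U f -> U p0 ->
  forall e : R, 0 < e -> exists2 d : R, 0 < d & forall q (c : R), `|q - p0| < d -> `|c| < d ->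
    `|f (q + c *: v) - f q - c * 'D_v f p0| <= e * `|c|.
Proof.
move=> [oU [_ /(_ v)[df cf]]] Up0 e e0.
have /nbhs_ballP[r /= r0 rU] : nbhs p0 (U `&` [set q | `|'D_v f p0 - 'D_v f q| <= e]).
  apply: filterI; first exact: open_nbhs_nbhs.
  by have /cvgrPdist_le := cf p0 Up0; exact.
have v0 : 0 < 2 * (`|v| + 1) by rewrite mulr_gt0// ltr_wpDl.
exists (Num.min (r / 2) (r / (2 * (`|v| + 1)))); first by rewrite lt_min !divr_gt0.
move=> q c; rewrite !lt_min => /andP[q1 _] /andP[_].
rewrite ltr_pdivlMr// => c1.
have B t : `|t| <= `|c| -> ball p0 r (q + t *: v).
  move=> tc; rewrite -ball_normE /= distrC addrAC (le_lt_trans (ler_normD _ _))//.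
  rewrite normrZ; have : `|t| * `|v| <= `|c| * `|v| by rewrite ler_wpM2r.
  have := normr_ge0 c; nra.
have [t tc ->] := line_mean_value f q v c (fun t tc => df _ (proj1 (rU _ (B t tc)))).
rewrite -mulrBr normrM mulrC ler_wpM2r// distrC.
exact: (proj2 (rU _ (B t tc))).
Qed.

(** One direction is added at a time. The increment along [v i] starts at [q] shifted by the
    remaining directions, so the one-direction estimate must allow a moving base point. *)
Lemma C1_open_strict (I : Type) (r : seq I) (v : I -> V) U f p0 :
  C1_open U f -> U p0 ->
  forall e : R, 0 < e -> exists2 d : R, 0 < d & forall q (c : I -> R),
    `|q - p0| < d -> (forall i, `|c i| < d) ->
    `|f (q + \sum_(i <- r) c i *: v i) - f q - \sum_(i <- r) c i * 'D_(v i) f p0|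
      <= e * \sum_(i <- r) `|c i|.
Proof.
move=> C1f Up0 e e0; elim: r => [|i r [d d0 IH]].
  by exists 1 => // q c _ _; rewrite !big_nil addr0 !subrr normr0 mulr0.
have [d1 d10 H1] := C1_open_strict1 _ _ _ (v i) C1f Up0 _ e0.
pose K := \sum_(j <- r) `|v j| + 1.
have S0 : 0 <= \sum_(j <- r) `|v j| by apply: sumr_ge0.
have K0 : 0 < 2 * K by rewrite /K; lra.
(* Half of [d1] is for [q - p0]; the bound [d1 / (2 * K)] on the coefficients keeps the shift [S]
   within the other half. *)
exists (Num.min d (Num.min (d1 / 2) (d1 / (2 * K)))).
  by rewrite !lt_min d0 !divr_gt0.
move=> q c; rewrite !lt_min => /and3P[q1 q2 _] cd.
set S := \sum_(j <- r) c j *: v j.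
have {IH} := IH q c q1 (fun j => _).
have cd1 j : `|c j| < d by have := cd j; rewrite !lt_min => /and3P[].
have cd2 j : `|c j| < d1 / 2 by have := cd j; rewrite !lt_min => /and3P[].
have cd3 j : `|c j| < d1 / (2 * K) by have := cd j; rewrite !lt_min => /and3P[].
move=> /(_ cd1); rewrite -/S => IH.
have SK : `|S| <= d1 / 2.
  have : `|S| <= d1 / (2 * K) * \sum_(j <- r) `|v j|.
    rewrite (le_trans (ler_norm_sum _ _ _))// mulr_sumr ler_sum// => j _.
    by rewrite normrZ ler_wpM2r// ltW.
  have E : d1 / (2 * K) * K = d1 / 2 by field; rewrite gt_eqF//; rewrite /K in K0 *; lra.
  have : d1 / (2 * K) * \sum_(j <- r) `|v j| <= d1 / (2 * K) * K.
    by rewrite ler_wpM2l// ?lerDl// divr_ge0// ltW.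
  lra.
have {}H1 := H1 (q + S) (c i).
have {}H1 : `|f (q + S + c i *: v i) - f (q + S) - c i * 'D_(v i) f p0| <= e * `|c i|.
  apply: H1; last by have := cd2 i; lra.
  by rewrite addrAC (le_lt_trans (ler_normD _ _))//; lra.
rewrite !big_cons -/S mulrDr (addrC (c i *: _)) addrA.
apply: le_trans (lerD H1 IH); rewrite (le_trans _ (ler_normD _ _))//.
by rewrite le_eqVlt; apply/orP; left; apply/eqP/(congr1 Num.norm); ring.
Qed.

End StrictDifferentiability.

Section Curve.
Context {R : realType} {V : normedModType R} (I : finType) (v : I -> V) (c : I -> R -> R).
Implicit Types (a b t : R).

(** With the directions [dir3] and [dir4] below, this covers [(t, x t, 0)] and
    [(t, x t, Dx x t, z t)]; with [V = R^o] it is a finite sum of scalar functions with constant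
    coefficients. *)
Let curve t : V := \sum_i c i t *: v i.

Lemma curveB t u : curve u = curve t + \sum_i (c i u - c i t) *: v i.
Proof. by rewrite -big_split/=; apply: eq_bigr => i _; rewrite -scalerDl addrC subrK. Qed.

Lemma curve_cont a b t :
  (forall i, cont_on a b (c i) t) ->
  forall e : R, 0 < e -> exists2 d : R, 0 < d & forall u : R, a <= u <= b -> `|u - t| < d ->
     `|curve u - curve t| < e.
Proof.
move=> cc e e0.
have S0 : 0 <= \sum_i `|v i| by apply: sumr_ge0.
have K0 : 0 < \sum_i `|v i| + 1 by lra.
have [d d0 Hd] : exists2 d : R, 0 < d & forall i u, a <= u <= b -> `|u - t| < d ->
     `|c i u - c i t| < e / (\sum_i `|v i| + 1).
  apply: fin_radius => [i d d' _ dd' H u uab ud|i]; last exact: cc (divr_gt0 e0 K0).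
  exact: H (lt_le_trans ud dd').
exists d => // u uab ud; rewrite (curveB t u) addrC addKr.
rewrite (@le_lt_trans _ _ (e / (\sum_i `|v i| + 1) * \sum_i `|v i|))//; last first.
  by rewrite mulrAC -mulrA gtr_pMr// ltr_pdivrMr// mul1r ltrDl.
rewrite (le_trans (ler_norm_sum _ _ _))// mulr_sumr ler_sum// => i _.
by rewrite normrZ ler_wpM2r// ltW// Hd.
Qed.

Lemma has_deriv_on_lipschitz a b (f : R -> R) t l : has_deriv_on a b f t l ->
  exists2 d : R, 0 < d & forall u : R, a <= u <= b -> `|u - t| < d ->
    `|f u - f t| <= (`|l| + 1) * `|u - t|.
Proof.
move=> /has_deriv_onP/(_ 1 ltr01)[d d0 H]; exists d => // u uab /(H u uab) {}H.
have := ler_normD (f u - f t - l * (u - t)) (l * (u - t)).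
by rewrite subrK normrM; lra.
Qed.

Lemma has_deriv_on_sum a b t (f : I -> R -> R) (l : I -> R) :
  (forall i, has_deriv_on a b (f i) t (l i)) ->
  has_deriv_on a b (fun u => \sum_i f i u) t (\sum_i l i).
Proof.
move=> H; elim: (index_enum I) => [|i r IH].
  apply/has_deriv_onP => e e0; exists 1 => // u _ _.
  by rewrite !big_nil subrr mul0r subrr normr0 mulr_ge0// ltW.
under eq_fun do rewrite big_cons; rewrite big_cons.
exact: has_deriv_onD.
Qed.

Lemma has_deriv_on_curve U (f : V -> R) a b t (c' : I -> R) :
  C1_open U f -> U (curve t) -> (forall i, has_deriv_on a b (c i) t (c' i)) ->
  has_deriv_on a b (f \o curve) t (\sum_i c' i * 'D_(v i) f (curve t)).
Proof.
move=> C1f Ut cc'.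
(* Linear part with coefficients frozen at [t]. What remains is at most a small multiple of the
   coordinate increments, which are [O(|u - t|)], so its derivative is [0]. *)
pose lin u := \sum_i 'D_(v i) f (curve t) * c i u.
have dlin : has_deriv_on a b lin t (\sum_i c' i * 'D_(v i) f (curve t)).
  under eq_bigr do rewrite mulrC.
  by apply: has_deriv_on_sum => i; exact: has_deriv_onZ.
suff rem : has_deriv_on a b (fun u => f (curve u) - lin u) t 0.
  have := has_deriv_onD _ _ _ _ _ _ _ rem dlin; rewrite add0r.
  by under eq_fun do rewrite subrK.
apply/has_deriv_onP => e e0.
have S0 : 0 <= \sum_i (`|c' i| + 1) by apply: sumr_ge0 => i _; rewrite addr_ge0.
have K0 : 0 < \sum_i (`|c' i| + 1) + 1 by lra.
have [d d0 Hd] := C1_open_strict _ (index_enum I) v _ _ _ C1f Ut _ (divr_gt0 e0 K0).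
have [d1 d10 Hd1] : exists2 d : R, 0 < d & forall i u, a <= u <= b -> `|u - t| < d ->
     `|c i u - c i t| <= (`|c' i| + 1) * `|u - t|.
  apply: fin_radius => [i d' d'' _ dd' H u uab ud|i]; last exact: has_deriv_on_lipschitz.
  exact: H (lt_le_trans ud dd').
have [d2 d20 Hd2] : exists2 d' : R, 0 < d' & forall i u, a <= u <= b -> `|u - t| < d' ->
     `|c i u - c i t| < d.
  apply: fin_radius => [i d' d'' _ dd' H u uab ud|i]; last exact: has_deriv_on_cont.
  exact: H (lt_le_trans ud dd').
exists (Num.min d1 d2); first by rewrite lt_min d10.
move=> u uab; rewrite lt_min => /andP[ud1 ud2].
have := Hd (curve t) (fun i => c i u - c i t).
rewrite subrr normr0 => /(_ d0 (fun i => Hd2 i u uab ud2)).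
rewrite -curveB => H.
have -> : f (curve u) - lin u - (f (curve t) - lin t) - 0 * (u - t) =
    f (curve u) - f (curve t) - \sum_i (c i u - c i t) * 'D_(v i) f (curve t).
  rewrite (_ : \sum_i _ = lin u - lin t); first by ring.
  by rewrite /lin -sumrB; apply: eq_bigr => i _; ring.
rewrite (le_trans H)//.
have : \sum_i `|c i u - c i t| <= \sum_i (`|c' i| + 1) * `|u - t|.
  by apply: ler_sum => i _; exact: Hd1.
rewrite -mulr_suml => {}H.
rewrite -mulrA ler_wpM2l ?(ltW e0)// mulrC ler_pdivrMr// mulrC.
by have := normr_ge0 (u - t); nra.
Qed.

Lemma C1_on_curve U (f : V -> R) a b : a < b ->
  C1_open U f -> (forall t : R, a <= t <= b -> U (curve t)) -> (forall i, C1_on a b (c i)) ->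
  C1_on a b (f \o curve).
Proof.
move=> ab C1f Uc C1c.
have D t : a <= t <= b -> has_deriv_on a b (f \o curve) t
    (\sum_i deriv_on a b (c i) t * 'D_(v i) f (curve t)).
  move=> tab; apply: has_deriv_on_curve C1f (Uc t tab) _ => i.
  exact: (C1c i).1.
split=> [t tab|]; first exact: (cvgP _ (D t tab)).
have E : {in [set` `[a, b]], deriv_on a b (f \o curve) =1
    (fun t => \sum_i deriv_on a b (c i) t * 'D_(v i) f (curve t))}.
  move=> t; rewrite inE/= in_itv/= => tab.
  exact: has_deriv_onE ab tab (D t tab).
apply: (subspace_eq_continuous (f := fun t => \sum_i deriv_on a b (c i) t * 'D_(v i) f (curve t))).
  by move=> t tab; exact/esym/E.
apply/subspace_continuousP => t tab; have := tab; rewrite /= in_itv/= => tab'.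
apply: cvg_big => [|i _]; [exact: add_continuous|apply: cvgM].
  by have /subspace_continuousP := (C1c i).2; exact.
have cv : curve u @[u --> within `[a, b] (nbhs t)] --> curve t.
  apply/cvgrPdist_lt => e e0.
  have [d d0 H] := curve_cont a b t (fun i => has_deriv_on_cont _ _ _ _ _ ((C1c i).1 t tab')) e e0.
  exists d => // u /= tu; rewrite in_itv/= => uab; rewrite distrC.
  by apply: H => //; rewrite distrC.
have [_ [_ /(_ (v i))[_ /(_ _ (Uc t tab'))]]] := C1f.
exact: (cvg_comp _ _ cv).
Qed.

End Curve.

(** * The fractional integral *)

Section PowerKernel.
Context {R : realType} (al : R).
Hypothesis al01 : 0 < al < 1.
Implicit Types a b c t : R.
Notation mu := (@lebesgue_measure R).

Let ker t : R -> R := fun tau => (t - tau) `^ (- al).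

Let al1_gt0 : 0 < 1 - al. Proof. by move: al01 => /andP[]; lra. Qed.
Let al1 : 1 - al != 0. Proof. by rewrite gt_eqF. Qed.

Lemma is_derive_kernel_primitive t (u : R) : u < t ->
  is_derive u 1 (fun w => - (1 - al)^-1 * (t - w) `^ (1 - al)) (ker t u).
Proof.
move=> ut; have tu0 : 0 < t - u by rewrite subr_gt0.
pose g (w : R) : R := t - w.
have dg : is_derive u 1 g (-1).
  by rewrite -[-1]add0r /g; apply: is_deriveB.
have dp := is_derive1_powR (1 - al) tu0.
have dpg := @is_derive1_comp R (fun x => x `^ (1 - al)) g u _ _ dp dg.
have := is_deriveZ (- (1 - al)^-1) dpg.
rewrite /GRing.scale/= (_ : _ * (_ * -1) = ker t u)//.
by rewrite /ker (_ : 1 - al - 1 = - al); [field|ring].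
Qed.

Lemma integral_kernel_cc a c t : a < c -> c < t ->
  (\int[mu]_(u in `[a, c]) (ker t u)%:E =
   ((1 - al)^-1 * ((t - a) `^ (1 - al) - (t - c) `^ (1 - al)))%:E)%E.
Proof.
move=> ac ct.
pose F := fun w : R => - (1 - al)^-1 * (t - w) `^ (1 - al).
have dF u : u <= c -> is_derive u 1 F (ker t u).
  by move=> uc; apply: is_derive_kernel_primitive; exact: le_lt_trans ct.
have cF u : u <= c -> {for u, continuous F}.
  by move=> /dF[dFu _]; exact/differentiable_continuous/derivable1_diffP.
rewrite (@continuous_FTC2 R _ F)//.
- by rewrite -EFinB /F; congr EFin; ring.
- apply/subspace_continuousP => u /=; rewrite in_itv/= => /andP[_ uc].
  apply: cvg_within_filter.
  have tu : 0 < t - u by rewrite subr_gt0 (le_lt_trans uc).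
  have dpk := is_derive1_powR (- al) tu.
  apply: (@continuous_comp _ _ _ (fun w => t - w) (fun w : R => w `^ (- al))).
    by apply: cvgB; [exact: cvg_cst|].
  by apply/differentiable_continuous/derivable1_diffP; case: dpk.
- split.
  + by move=> u; rewrite in_itv/= => /andP[_ /ltW/dF[]].
  + exact/cvg_at_right_filter/cF/ltW.
  + exact/cvg_at_left_filter/cF.
- move=> u; rewrite in_itv/= => /andP[_ /ltW/dF H]; rewrite derive1E.
  exact: derive_val.
Qed.

Lemma measurable_kernel t (D : set R) : measurable_fun D (ker t).
Proof.
apply: measurable_funTS.
apply: (measurableT_comp (measurable_powR (- al))).
by apply: measurable_funB.
Qed.

(** The kernel is singular at [t], so the fundamental theorem is used on [[a, t - w n]] and monotone
    convergence does the rest; the boundary terms [w n] to the power [1 - al] vanish in the limit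
    because [1 - al > 0]. *)
Lemma integral_kernel a t : a < t ->
  (\int[mu]_(u in `]a, t[) (ker t u)%:E =
   ((1 - al)^-1 * (t - a) `^ (1 - al))%:E)%E.
Proof.
move=> at_; have ta0 : 0 < (t - a) / 2 by rewrite divr_gt0// subr_gt0.
(* Half the length, so that [a < t - w n] already at [n = 0], where [harmonic] is [1]. *)
pose w n : R := (t - a) / 2 * harmonic n.
have w0 n : 0 < w n by rewrite mulr_gt0// harmonic_gt0.
have wta n : w n < t - a.
  rewrite (@le_lt_trans _ _ ((t - a) / 2))//; last lra.
  by rewrite ger_pMr// invf_le1// ler1n.
pose F n := [set` `[a, t - w n]].
have UF : \bigcup_n F n = [set` `[a, t[].
  apply/seteqP; split => u /=.
    move=> [n _]; rewrite /F /= !in_itv/= => /andP[-> /=] utw.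
    by have := w0 n; lra.
  rewrite in_itv/= => /andP[au ut]; have tu0 : 0 < t - u by rewrite subr_gt0.
  have := archi_boundP (ltW (divr_gt0 ta0 tu0)).
  set n := Num.bound _ => nP; exists n => //; rewrite /F /= in_itv/= au/=.
  suff : w n <= t - u by lra.
  rewrite /w /= ler_pdivrMr ?ltr0n// -ler_pdivrMl//.
  rewrite [leLHS]mulrC (le_trans (ltW nP))//.
  by rewrite ler_nat.
rewrite integral_itv_obnd_cbnd; last first.
  by apply/measurable_EFinP; exact: measurable_kernel.
have H : (\int[mu]_(u in F n) (ker t u)%:E)%E @[n --> \oo] -->
    (\int[mu]_(u in \bigcup_n F n) (ker t u)%:E)%E.
  apply: ge0_nondecreasing_set_cvg_integral.
  - apply/nondecreasing_seqP => n; apply/subsetPset => u.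
    rewrite /F /= !in_itv/= => /andP[-> /= un]; rewrite (le_trans un)// lerD2l lerN2.
    by rewrite /w ler_pM2l// lef_pV2 ?posrE ?ltr0n// ler_nat.
  - by move=> n; exact: measurable_itv.
  - by move=> n; apply/measurable_EFinP; exact: measurable_kernel.
  - by move=> n u _; rewrite lee_fin powR_ge0.
rewrite -UF -(cvg_lim _ H)//; apply/cvg_lim => //.
have -> : (fun n => \int[mu]_(u in F n) (ker t u)%:E)%E =
    EFin \o (fun n => (1 - al)^-1 * ((t - a) `^ (1 - al) - (w n) `^ (1 - al))).
  apply/funext => n /=; rewrite integral_kernel_cc ?subKr//.
    by have := wta n; lra.
  by rewrite gtrBl.
apply: cvg_EFin; first exact: nearW.
rewrite -[in X in _ --> X](subr0 ((t - a) `^ (1 - al))).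
apply: cvgMl_tmp; apply: cvgB; first exact: cvg_cst.
apply: (@cvg_comp _ _ _ w (fun x : R => x `^ (1 - al)) _ (0^'+)); last exact: powR_cvg0.
have wc : w @ \oo --> 0.
  by rewrite -(mulr0 ((t - a) / 2)); apply: cvgMl_tmp; exact: cvg_harmonic.
move=> A [e /= e0 eA]; have /cvgrPdist_lt/(_ e e0) := wc.
by apply: filterS => n /= wn; exact: eA.
Qed.

Lemma integrable_kernel a t : mu.-integrable `]a, t[ (EFin \o ker t).
Proof.
apply/integrableP; split.
  by apply/measurable_EFinP; exact: measurable_kernel.
under eq_integral do rewrite /= ger0_norm ?powR_ge0//.
have [at_|ta] := ltP a t; first by rewrite integral_kernel// ltry.
by rewrite set_itv_ge ?bnd_simp -?leNgt// integral_set0.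
Qed.

Lemma Rintegral_kernel a t : a <= t ->
  \int[mu]_(u in `]a, t[) ker t u = (1 - al)^-1 * (t - a) `^ (1 - al).
Proof.
rewrite le_eqVlt => /predU1P[->|at_]; last by rewrite /Rintegral integral_kernel.
by rewrite set_itvoo0// Rintegral_set0 subrr powR0// mulr0.
Qed.

Lemma integrableZ_EFin (D : set R) (f : R -> R) (B : R) : measurable D ->
  mu.-integrable D (EFin \o f) -> mu.-integrable D (EFin \o (fun u => B * f u)).
Proof.
move=> mD fi; rewrite (_ : EFin \o _ = (fun u => B%:E * (EFin \o f) u)%E).
  exact: integrableZl.
by apply/funext => u; rewrite /= EFinM.
Qed.

Lemma integrableB_EFin (D : set R) (f g : R -> R) : measurable D ->
  mu.-integrable D (EFin \o f) -> mu.-integrable D (EFin \o g) ->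
  mu.-integrable D (EFin \o (fun u => f u - g u)).
Proof.
move=> mD fi gi; rewrite (_ : EFin \o _ = (EFin \o f) \- (EFin \o g))%E.
  exact: integrableB.
by apply/funext => u; rewrite /= EFinB.
Qed.

Lemma integrable_kernelM (g : R -> R) (B : R) a b t :
  {within `[a, b], continuous g} -> (forall u : R, a <= u <= b -> `|g u| <= B) -> t <= b ->
  mu.-integrable `]a, t[ (EFin \o (fun u => ker t u * g u)).
Proof.
move=> cg gB tb.
apply: (@le_integrable _ _ _ mu _ (measurable_itv _) _ (EFin \o (fun u => B * ker t u))).
- apply/measurable_EFinP/measurable_funM; first exact: measurable_kernel.
  apply: (@measurable_funS _ _ _ _ `[a, b]) => //.
    by move=> u /=; rewrite !in_itv/= => /andP[? ?]; apply/andP; split; lra.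
  exact: subspace_continuous_measurable_fun.
- move=> u; rewrite /= in_itv/= => /andP[au ut].
  have uab : a <= u <= b by apply/andP; split; lra.
  rewrite lee_fin !normrM mulrC ler_wpM2r// (le_trans (gB u uab))//.
  exact: ler_norm.
- by apply: integrableZ_EFin => //; exact: integrable_kernel.
Qed.

(* Splitting off [`]t, t'[], the difference is controlled by
   [\int_(]a,t[) (ker t - ker t')] and [\int_(]t,t'[) ker t'], both explicit powers. *)
Lemma frac_integral_holder (g : R -> R) (B : R) a b t t' :
  {within `[a, b], continuous g} -> (forall u : R, a <= u <= b -> `|g u| <= B) ->
  a <= t -> t <= t' -> t' <= b ->
  `|\int[mu]_(u in `]a, t'[) (ker t' u * g u) - \int[mu]_(u in `]a, t[) (ker t u * g u)|
    <= 2 * B * (1 - al)^-1 * (t' - t) `^ (1 - al).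
Proof.
move=> cg gB at_ tt' t'b.
have B0 : 0 <= B by apply: le_trans (gB a _) => //; apply/andP; split; lra.
have [<-|tt'n] := eqVneq t t'.
  by rewrite !subrr normr0 !mulr_ge0// ?powR_ge0// invr_ge0 ltW.
have {}tt' : t < t' by rewrite lt_neqAle tt'n.
have ikg := integrable_kernelM g B a b.
have ik' : mu.-integrable `]a, t'[ (EFin \o ker t') by exact: integrable_kernel.
have sub : [set` `]a, t[] `<=` [set` `]a, t'[].
  by move=> u /=; rewrite !in_itv/= => /andP[-> ut] /=; exact: lt_trans tt'.
have sub2 : [set` `]t, t'[] `<=` [set` `]a, t'[].
  by move=> u /=; rewrite !in_itv/= => /andP[tu ->]; rewrite andbT (le_lt_trans at_).
have iS f : mu.-integrable `]a, t'[ f -> mu.-integrable `]a, t[ f.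
  by apply: integrableS => //; exact: measurable_itv.
have iS2 f : mu.-integrable `]a, t'[ f -> mu.-integrable `]t, t'[ f.
  by apply: integrableS => //; exact: measurable_itv.
have split f : mu.-integrable `]a, t'[ (EFin \o f) ->
    \int[mu]_(u in `]a, t'[) f u = \int[mu]_(u in `]a, t[) f u + \int[mu]_(u in `]t, t'[) f u.
  move=> fi; rewrite (Rintegral_itv_bndo_bndc (iS _ fi)).
  by have := Rintegral_itvB fi (x := t); rewrite !bnd_simp => /(_ at_ tt'); lra.
have i' := ikg t' cg gB t'b.
have i0 := ikg t cg gB (ltW (lt_le_trans tt' t'b)).
rewrite (split _ i') addrAC -RintegralB//; [|exact: iS].
have ker_le u : a < u < t -> ker t' u <= ker t u.
  move=> /andP[au ut]; rewrite /ker !powRN lef_pV2 ?posrE ?powR_gt0; [|lra..].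
  by rewrite ge0_ler_powR ?nnegrE; move: al01 => /andP[? ?]; lra.
have gab u : a < u < t' -> `|g u| <= B.
  by move=> /andP[? ?]; apply: gB; apply/andP; split; lra.
have ikB : mu.-integrable `]a, t[ (EFin \o (fun u => B * (ker t u - ker t' u))).
  apply: integrableZ_EFin => //.
  apply: integrableB_EFin => //; first exact: integrable_kernel.
  exact: iS.
have ikB2 : mu.-integrable `]t, t'[ (EFin \o (fun u => B * ker t' u)).
  by apply: integrableZ_EFin => //; exact: iS2.
have b1 : `|\int[mu]_(u in `]a, t[) (ker t' u * g u - ker t u * g u)| <=
    B * (1 - al)^-1 * (t' - t) `^ (1 - al).
  apply: (@le_trans _ _ (\int[mu]_(u in `]a, t[) (B * (ker t u - ker t' u)))).
    have iB : mu.-integrable `]a, t[ (EFin \o (fun u => ker t' u * g u - ker t u * g u)).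
      by apply: integrableB_EFin => // => //; exact: iS.
    apply: (le_trans (le_normr_Rintegral _ iB)) => //.
    apply: le_Rintegral => //.
      exact: (@integrable_norm _ _ _ mu).
    move=> u /=; rewrite in_itv/= => uat; rewrite -mulrBl normrM mulrC.
    have := ker_le u uat; rewrite distrC => kl.
    rewrite (@ger0_norm _ (ker t u - _)) ?subr_ge0//.
    rewrite ler_wpM2r ?subr_ge0//; apply: gab.
    by move: uat => /andP[-> ut]; rewrite (lt_trans ut).
  have ikt : mu.-integrable `]a, t[ (EFin \o (fun u => ker t u - ker t' u)).
    apply: integrableB_EFin => //; first exact: integrable_kernel.
    exact: iS.
  rewrite RintegralZl// -mulrA ler_wpM2l// RintegralB//; last 2 first.
  - exact: integrable_kernel.
  - exact: iS.
  (* [Rintegral_kernel] only covers intervals ending at the singularity, so the integral up to [t]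
     is written as a difference of two integrals up to [t']. *)
  have -> : \int[mu]_(u in `]a, t[) ker t' u =
      \int[mu]_(u in `]a, t'[) ker t' u - \int[mu]_(u in `]t, t'[) ker t' u.
    by rewrite (split _ ik'); ring.
  rewrite !Rintegral_kernel ?(ltW tt')//; last lra.
  have c0 : 0 <= (1 - al)^-1 by rewrite invr_ge0 ltW.
  rewrite -!mulrBr ler_wpM2l//.
  (* With [p = 1 - al], the left side is [(t - a)^p - (t' - a)^p + (t' - t)^p], and its first two
     terms add up to at most [0]. *)
  have : (t - a) `^ (1 - al) <= (t' - a) `^ (1 - al).
    by rewrite ge0_ler_powR ?nnegrE ?(ltW al1_gt0)//; lra.
  lra.
have b2 : `|\int[mu]_(u in `]t, t'[) (ker t' u * g u)| <=
    B * (1 - al)^-1 * (t' - t) `^ (1 - al).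
  apply: (@le_trans _ _ (\int[mu]_(u in `]t, t'[) (B * ker t' u))).
    apply: (le_trans (le_normr_Rintegral _ (iS2 _ i'))) => //.
    apply: le_Rintegral => //.
      by apply: (@integrable_norm _ _ _ mu); exact: iS2.
    move=> u /=; rewrite in_itv/= => /andP[tu ut']; rewrite normrM mulrC.
    rewrite (ger0_norm (powR_ge0 _ _)) ler_wpM2r ?powR_ge0//.
    by apply: gab; rewrite ut' (le_lt_trans at_).
  rewrite RintegralZl//; last exact: iS2.
  by rewrite Rintegral_kernel ?mulrA// ltW.
rewrite (le_trans (ler_normD _ _))// (le_trans (lerD b1 b2))//.
by rewrite -!mulrDl -mulr2n mulr_natl.
Qed.

End PowerKernel.

(** * Linearity and continuity of the Caputo derivative *)

Section Caputo.
Context {R : realType}.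
Implicit Types (a b al t : R) (f g : R -> R).
Notation mu := (@lebesgue_measure R).

Lemma within_continuous_bounded a b g : a <= b -> {within `[a, b], continuous g} ->
  exists B, forall u : R, a <= u <= b -> `|g u| <= B.
Proof.
move=> ab /within_itv_continuousP cg.
have cng : {within `[a, b], continuous (fun u => `|g u|)}.
  apply/within_itv_continuousP => t tab e e0; have [d d0 H] := cg t tab e e0.
  by exists d => // u uab /(H u uab); apply: le_lt_trans; exact: ler_dist_dist.
have [c _ cmax] := EVT_max ab cng.
by exists `|g c| => u uab; apply: cmax; rewrite in_itv.
Qed.

Lemma caputo_linear a b al f g (s t : R) : a < b -> 0 < al < 1 ->
  C1_on a b f -> C1_on a b g -> a <= t <= b ->
  caputo a b al (fun u => f u + s * g u) t = caputo a b al f t + s * caputo a b al g t.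
Proof.
move=> ab al01 [df cf] [dg cg] /andP[at_ tb].
have [B fB] := within_continuous_bounded _ _ _ (ltW ab) cf.
have [C gC] := within_continuous_bounded _ _ _ (ltW ab) cg.
have i_f := integrable_kernelM _ al01 _ _ _ _ _ cf fB tb.
have i_g := integrable_kernelM _ al01 _ _ _ _ _ cg gC tb.
rewrite /caputo mulrCA -mulrDr; congr (_ * _).
rewrite -RintegralZl// -RintegralD//; last exact: integrableZ_EFin.
apply: eq_Rintegral => u; rewrite inE/= in_itv/= => /andP[au ut].
have uab : a <= u <= b by apply/andP; split; lra.
rewrite (has_deriv_onE _ _ _ _ _ ab uab
  (has_deriv_onD _ _ _ _ _ _ _ (df u uab) (has_deriv_onZ _ _ _ _ _ s (dg u uab)))).
by rewrite mulrDr mulrCA.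
Qed.

Lemma caputo_continuous a b al f : a < b -> 0 < al < 1 -> C1_on a b f ->
  {within `[a, b], continuous (caputo a b al f)}.
Proof.
move=> ab al01 [_ cf]; have [B fB] := within_continuous_bounded _ _ _ (ltW ab) cf.
have al10 : 0 < 1 - al by move: al01 => /andP[]; lra.
pose K := `|(Gamma (1 - al))^-1| * (2 * B * (1 - al)^-1).
have B0 : 0 <= B by apply: le_trans (fB a _) => //; rewrite lexx ltW.
have K0 : 0 <= K by rewrite /K !mulr_ge0// invr_ge0 ltW.
have K10 : 0 < K + 1 by lra.
have H u t : a <= u <= b -> a <= t <= b ->
    `|caputo a b al f u - caputo a b al f t| <= K * `|u - t| `^ (1 - al).
  wlog tu : u t / t <= u.
    move=> W uab tab; case: (leP t u) => [tu|/ltW ut]; first exact: W tu uab tab.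
    by rewrite distrC (distrC u); exact: W ut tab uab.
  move=> /andP[au ub] /andP[at_ tb]; rewrite (@ger0_norm _ (u - t)) ?subr_ge0//.
  rewrite /caputo -mulrBr normrM /K -mulrA ler_wpM2l//.
  exact: (frac_integral_holder _ al01 _ _ _ _ _ _ cf fB).
apply/within_itv_continuousP => t tab e e0.
have q0 : 0 < e / (K + 1) by rewrite divr_gt0.
(* The radius [r] solves [(K + 1) * r^(1 - al) = e]; the [+ 1] allows [K = 0]. *)
exists ((e / (K + 1)) `^ (1 - al)^-1); first exact: powR_gt0.
move=> u uab ut; rewrite (le_lt_trans (H u t uab tab))//.
have : `|u - t| `^ (1 - al) < e / (K + 1).
  have -> : e / (K + 1) = ((e / (K + 1)) `^ (1 - al)^-1) `^ (1 - al).
    by rewrite -powRrM mulVf ?lt0r_neq0// powRr1 ?ltW.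
  by rewrite gt0_ltr_powR// nnegrE powR_ge0.
rewrite ltr_pdivlMr// => H1.
have := powR_ge0 `|u - t| (1 - al); nra.
Qed.

End Caputo.

(** * Linearization and invariance *)

Section Coordinates.
Context {R : realType} {n : nat}.
Implicit Types (X Y : 'rV[R]_n) (u w : R).

(** The parameter direction is left out: [xi] is evaluated at parameter [0], and along the
    trajectory only [(t, x t)] moves. *)
Definition dir3 (i : 'I_1 + 'I_n) : R * 'rV[R]_n * R :=
  match i with inl _ => (1, 0, 0) | inr k => (0, erow R k, 0) end.

Definition coord3 u X (i : 'I_1 + 'I_n) : R :=
  match i with inl _ => u | inr k => X ord0 k end.

Definition dir4 (i : 'I_1 + 'I_n + 'I_n + 'I_1) : R * 'rV[R]_n * 'rV[R]_n * R :=
  match i with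
  | inl (inl (inl _)) => (1, 0, 0, 0)
  | inl (inl (inr k)) => (0, erow R k, 0, 0)
  | inl (inr k) => (0, 0, erow R k, 0)
  | inr _ => (0, 0, 0, 1)
  end.

Definition coord4 u X Y w (i : 'I_1 + 'I_n + 'I_n + 'I_1) : R :=
  match i with
  | inl (inl (inl _)) => u
  | inl (inl (inr k)) => X ord0 k
  | inl (inr k) => Y ord0 k
  | inr _ => w
  end.

Lemma sum_erow X : \sum_k X ord0 k *: erow R k = X.
Proof. by rewrite [RHS]row_sum_delta. Qed.

Lemma sum_erow_linear (V : lmodType R) (phi : 'rV[R]_n -> V) X :
  (forall c Y Z, phi (c *: Y + Z) = c *: phi Y + phi Z) ->
  \sum_k X ord0 k *: phi (erow R k) = phi X.
Proof.
move=> phiL.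
have phi0 : phi 0 = 0.
  by have := phiL (-1) 0 0; rewrite scaler0 addr0 scaleN1r addNr.
rewrite -[in RHS](sum_erow X); elim: (index_enum _) => [|k r IH].
  by rewrite !big_nil phi0.
by rewrite !big_cons IH phiL.
Qed.

Lemma sum_coord3 u X : \sum_i coord3 u X i *: dir3 i = (u, X, 0).
Proof.
rewrite big_sumType/= big_ord1 (sum_erow_linear _ (fun Z => (0, Z, 0) : R * 'rV[R]_n * R)).
  by congr (_, _, _) => /=; rewrite ?scaler0 ?addr0 ?add0r ?[_ *: 1]mulr1.
by move=> c Y Z; congr (_, _, _); rewrite /= scaler0 addr0.
Qed.

Lemma sum_coord4 u X Y w : \sum_i coord4 u X Y w i *: dir4 i = (u, X, Y, w).
Proof.
rewrite !big_sumType/= !big_ord1.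
rewrite (sum_erow_linear _ (fun Z => (0, Z, 0, 0) : R * 'rV[R]_n * 'rV[R]_n * R)); last first.
  by move=> c Z Z'; congr (_, _, _, _); rewrite /= scaler0 addr0.
rewrite (sum_erow_linear _ (fun Z => (0, 0, Z, 0) : R * 'rV[R]_n * 'rV[R]_n * R)); last first.
  by move=> c Z Z'; congr (_, _, _, _); rewrite /= scaler0 addr0.
by congr (_, _, _, _) => /=; rewrite ?scaler0 ?addr0 ?add0r ?[_ *: 1]mulr1.
Qed.

End Coordinates.

(** The error budget: [e / 4] for each of the two sums when [p], [q] at time [t] are replaced by
    [p0], [q0] at [t0], and [e / 2] for the strict differentiability error. Since [e1 <= 1], the
    part of that error in [w] is at most [|w|], whence [|g| + 1]. *)
Lemma linearization_error_le {R : realType} (l s w p q p0 q0 m1 m2 k e e1 g : R) :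
  `|l - (s * p + s * q + w * g)| <= e1 * (`|s| * m1 + `|s| * m2 + `|w|) ->
  `|p - p0| < e / 4 -> `|q - q0| < e / 4 -> m1 + m2 <= k -> 0 <= k -> 0 < e1 -> e1 <= 1 ->
  2 * (k + 1) * e1 <= e ->
  `|l - s * (p0 + q0)| <= e * `|s| + (`|g| + 1) * `|w|.
Proof.
move=> H pp qq mk k0 e10 e11 e1k.
have -> : l - s * (p0 + q0) =
    (l - (s * p + s * q + w * g)) + (s * (p - p0) + s * (q - q0) + w * g) by ring.
rewrite (le_trans (ler_normD _ _))//.
have H1 : `|s * (p - p0) + s * (q - q0) + w * g| <= `|s| * (e / 4) + `|s| * (e / 4) + `|w| * `|g|.
  rewrite (le_trans (ler_normD _ _))// [`|w * g|]normrM lerD2r.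
  by rewrite (le_trans (ler_normD _ _))// !normrM lerD// ler_wpM2l// ltW.
have H2 : e1 * (`|s| * m1 + `|s| * m2 + `|w|) <= `|s| * (e / 2) + `|w|.
  have s0 := normr_ge0 s; have w0 := normr_ge0 w.
  have a1 : e1 * (m1 + m2) <= e / 2 by have := ler_wpM2l (ltW e10) mk; nra.
  have a2 := ler_wpM2l s0 a1; have a3 : e1 * `|w| <= `|w| by exact: ler_piMl.
  nra.
lra.
Qed.

Lemma sum_coord4_mul {R : realType} {n : nat} (s w : R) (X Y : 'rV[R]_n)
    (g : 'I_1 + 'I_n + 'I_n + 'I_1 -> R) :
  \sum_i coord4 0 (s *: X) (s *: Y) w i * g i =
    s * \sum_j X ord0 j * g (inl (inl (inr j))) + s * \sum_j Y ord0 j * g (inl (inr j)) +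
    w * g (inr ord0).
Proof.
rewrite !big_sumType/= !big_ord1 mul0r add0r !mulr_sumr.
by congr (_ + _ + _); apply: eq_bigr => j _; rewrite mxE mulrA.
Qed.

Lemma sum_norm_coord4 {R : realType} {n : nat} (s w : R) (X Y : 'rV[R]_n) :
  \sum_i `|coord4 0 (s *: X) (s *: Y) w i| =
    `|s| * \sum_j `|X ord0 j| + `|s| * \sum_j `|Y ord0 j| + `|w|.
Proof.
rewrite !big_sumType/= !big_ord1 normr0 add0r !mulr_sumr.
by congr (_ + _ + _); apply: eq_bigr => j _; rewrite mxE normrM.
Qed.

Section Linearization.
Context {R : realType} {n : nat} (a b t0 : R) (L : R * 'rV[R]_n * 'rV[R]_n * R -> R)
  (U : set (R * 'rV[R]_n * 'rV[R]_n * R)) (x D y Dy : R -> 'rV[R]_n) (z : R -> R).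

Let dx j := 'D_((0, erow R j, 0, 0)) L (t0, x t0, D t0, z t0).
Let dD j := 'D_((0, 0, erow R j, 0)) L (t0, x t0, D t0, z t0).
Let dz := 'D_((0, 0, 0, 1)) L (t0, x t0, D t0, z t0).

(** The slope must be one constant [G] near [t0], so all coefficients are frozen there, while the
    increment of [L] is taken at the moving point [(t, x t, D t, z t)]. This is where strictness is
    used. *)
Lemma C1_open_linearization :
  C1_open U L -> U (t0, x t0, D t0, z t0) ->
  (forall j, cont_on a b (fun t => x t ord0 j) t0) ->
  (forall j, cont_on a b (fun t => D t ord0 j) t0) ->
  (forall j, cont_on a b (fun t => y t ord0 j) t0) ->
  (forall j, cont_on a b (fun t => Dy t ord0 j) t0) ->
  cont_on a b z t0 ->
  forall e : R, 0 < e -> exists2 d : R, 0 < d & forall s w t : R, a <= t <= b ->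
    `|t - t0| < d -> `|s| < d -> `|w| < d ->
    `|L (t, x t + s *: y t, D t + s *: Dy t, z t + w) - L (t, x t, D t, z t) -
      s * \sum_j (y t0 ord0 j * dx j + Dy t0 ord0 j * dD j)|
    <= e * `|s| + (`|dz| + 1) * `|w|.
Proof.
move=> C1L Up cx cD cy cDy cz e e0.
have e40 : 0 < e / 4 by rewrite divr_gt0.
(* The two [+ 1] absorb the variation of [y] and [Dy] near [t0], so [k] bounds their coordinates and
   the sum of these there. *)
pose k := \sum_j ((`|y t0 ord0 j| + 1) + (`|Dy t0 ord0 j| + 1)).
have kj0 j : 0 <= (`|y t0 ord0 j| + 1) + (`|Dy t0 ord0 j| + 1) by rewrite !addr_ge0.
have k0 : 0 <= k by apply: sumr_ge0.
have k10 : 0 < 2 * (k + 1) by lra.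
have k1 : 0 < k + 1 by lra.
have kj j : (`|y t0 ord0 j| + 1) + (`|Dy t0 ord0 j| + 1) <= k.
  by rewrite /k (bigD1 j)//= lerDl sumr_ge0.
pose e1 := Num.min 1 (e / (2 * (k + 1))).
have e10 : 0 < e1 by rewrite lt_min ltr01 divr_gt0.
have e11 : e1 <= 1 by rewrite ge_min lexx.
have e1k : 2 * (k + 1) * e1 <= e by rewrite mulrC -ler_pdivlMr// ge_min lexx orbT.
have [d d0 strict] := C1_open_strict _ (index_enum _) dir4 _ _ _ C1L Up _ e10.
pose c t := coord4 t (x t) (D t) (z t).
have [d1 d10 pnear] : exists2 d1 : R, 0 < d1 & forall t : R, a <= t <= b -> `|t - t0| < d1 ->
    `|(t, x t, D t, z t) - (t0, x t0, D t0, z t0)| < d.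
  have := @curve_cont R _ _ dir4 (fun i t => c t i) a b t0.
  rewrite /c => H; have [|d1 d10 {}H] := H _ d d0.
    move=> [[[i|j]|j]|i] /=; [|exact: cx|exact: cD|exact: cz].
    by move=> e' e'0; exists e'.
  by exists d1 => // t tab /(H t tab); rewrite !sum_coord4.
have [d2 d20 ybnd] : exists2 d2 : R, 0 < d2 & forall j t, a <= t <= b -> `|t - t0| < d2 ->
    `|y t ord0 j| <= `|y t0 ord0 j| + 1.
  apply: fin_radius => [j d' d'' _ dd' H t tab td|j]; first exact: H (lt_le_trans td dd').
  have [d' d'0 H] := cy j 1 ltr01; exists d' => // t tab /(H t tab) {}H.
  by rewrite -lerBlDl (le_trans (lerB_dist _ _))// ltW.
have [d3 d30 Dybnd] : exists2 d3 : R, 0 < d3 & forall j t, a <= t <= b -> `|t - t0| < d3 ->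
    `|Dy t ord0 j| <= `|Dy t0 ord0 j| + 1.
  apply: fin_radius => [j d' d'' _ dd' H t tab td|j]; first exact: H (lt_le_trans td dd').
  have [d' d'0 H] := cDy j 1 ltr01; exists d' => // t tab /(H t tab) {}H.
  by rewrite -lerBlDl (le_trans (lerB_dist _ _))// ltW.
(* With the numbers [dx j] as vectors of [R^o], the sum of the [y_j * dx_j] is itself a curve. *)
have [d4 d40 yx] := @curve_cont R R^o _ dx (fun j t => y t ord0 j) a b t0 cy _ e40.
have [d5 d50 yD] := @curve_cont R R^o _ dD (fun j t => Dy t ord0 j) a b t0 cDy _ e40.
exists (Num.min (Num.min (Num.min d1 d2) (Num.min d3 d4))
  (Num.min d5 (Num.min d (d / (k + 1))))).
  by rewrite !lt_min d10 d20 d30 d40 d50 d0 divr_gt0.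
move=> s w t tab.
rewrite !lt_min => /andP[/andP[/andP[t1 t2] /andP[t3 t4]] /andP[t5 _]].
move=> /andP[_ /and3P[_ _]]; rewrite ltr_pdivlMr// => sk /andP[_ /and3P[_ wd _]].
have := strict (t, x t, D t, z t) (coord4 0 (s *: y t) (s *: Dy t) w) (pnear t tab t1).
rewrite sum_coord4 sum_norm_coord4 sum_coord4_mul.
have -> : (t, x t, D t, z t) + (0, s *: y t, s *: Dy t, w) =
    (t, x t + s *: y t, D t + s *: Dy t, z t + w) by congr (_, _, _, _); rewrite /= addr0.
have sd (v : R) : v <= k -> `|s| * v < d.
  by move=> vk; rewrite (le_lt_trans _ sk)// ler_wpM2l// (le_trans vk)// lerDl.
have small i : `|coord4 0 (s *: y t) (s *: Dy t) w i| < d.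
  move: i => [[[i|j]|j]|i] /=; rewrite ?normr0// mxE normrM; apply: sd.
  - by rewrite (le_trans (ybnd j t tab t2))// (le_trans _ (kj j))// lerDl addr_ge0.
  - by rewrite (le_trans (Dybnd j t tab t3))// (le_trans _ (kj j))// lerDr addr_ge0.
move=> /(_ small) H.
rewrite big_split/=.
apply: (linearization_error_le _ _ _ _ _ _ _ _ _ _ _ _ _ H) e1k => //.
- exact: yx t tab t4.
- exact: yD t tab t5.
- by rewrite -big_split/=; apply: ler_sum => j _; apply: lerD; [exact: ybnd|exact: Dybnd].
Qed.
End Linearization.

Lemma C1_on_id {R : realType} (a b : R) : a < b -> C1_on a b (fun t : R => t).
Proof.
move=> ab; have D t : has_deriv_on a b (fun u : R => u) t 1.
  by apply/has_deriv_onP => e e0; exists 1 => // u _ _; rewrite mul1r subrr normr0 mulr_ge0// ltW.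
split=> [t tab|]; first exact: cvgP (D t).
apply/within_itv_continuousP => t tab e e0; exists 1 => // u uab _.
by rewrite !(has_deriv_onE _ _ _ _ _ ab _ (D _))// subrr normr0.
Qed.

Lemma C1_on_comp {R : realType} {n : nat} (a b : R) (f : R * 'rV[R]_n * R -> R)
    (U : set (R * 'rV[R]_n * R)) (x : R -> 'rV[R]_n) :
  a < b -> C1_open U f -> (forall t : R, a <= t <= b -> U (t, x t, 0)) ->
  (forall j, C1_on a b (fun t => x t ord0 j)) -> C1_on a b (fun t => f (t, x t, 0)).
Proof.
move=> ab C1f Ux C1x.
have E t : \sum_i coord3 t (x t) i *: dir3 i = (t, x t, 0) by exact: sum_coord3.
have -> : (fun t => f (t, x t, 0)) = f \o (fun t => \sum_i coord3 t (x t) i *: dir3 i).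
  by apply/funext => t /=; rewrite E.
apply: (@C1_on_curve R _ _ dir3 (fun i t => coord3 t (x t) i) U) => // [t tab|[i|j]].
- by rewrite E; exact: Ux.
- exact: C1_on_id.
- exact: C1x.
Qed.

Lemma C1_on_cont {R : realType} (a b t : R) f :
  C1_on a b f -> a <= t <= b -> cont_on a b f t.
Proof. by move=> [df _] tab; apply: has_deriv_on_cont; exact: df. Qed.

(** Strict differentiability in the last direction, with error [1], gives the local Lipschitz
    constant [1 + |g|], where [g] is the derivative of [L] in that direction. *)
Lemma ode_unique_C1 {R : realType} {n : nat} (a b : R)
    (L : R * 'rV[R]_n * 'rV[R]_n * R -> R) (U : set (R * 'rV[R]_n * 'rV[R]_n * R))
    (x D : R -> 'rV[R]_n) (z1 z2 : R -> R) :
  a < b -> C1_open U L -> [set p | a <= p.1.1.1 <= b] `<=` U ->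
  (forall j, forall t : R, a <= t <= b -> cont_on a b (fun t => x t ord0 j) t) ->
  (forall j, forall t : R, a <= t <= b -> cont_on a b (fun t => D t ord0 j) t) ->
  z1 a = z2 a ->
  (forall t : R, a <= t <= b -> has_deriv_on a b z1 t (L (t, x t, D t, z1 t))) ->
  (forall t : R, a <= t <= b -> has_deriv_on a b z2 t (L (t, x t, D t, z2 t))) ->
  forall t : R, a <= t <= b -> z1 t = z2 t.
Proof.
move=> ab C1L LU cx cD za z1L z2L.
apply: (ode_unique a b (fun t w => L (t, x t, D t, w))) => // t0 t0ab.
have Up : U (t0, x t0, D t0, z1 t0) by exact: LU.
have [d d0 strict] := C1_open_strict1 _ _ _ ((0, 0, 0, 1) : R * 'rV[R]_n * 'rV[R]_n * R) C1L Up _ ltr01.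
set g := 'D_(0, 0, 0, 1) L _ in strict.
(* The last coordinate is a free variable in the Lipschitz condition. It is set to [0] here and put
   back in [pd], where the norm of a product is a maximum. *)
have [d1 d10 pnear] : exists2 d1 : R, 0 < d1 & forall t : R, a <= t <= b -> `|t - t0| < d1 ->
    `|(t, x t, D t, 0 : R) - (t0, x t0, D t0, 0 : R)| < d.
  have := @curve_cont R _ _ dir4 (fun i t => coord4 t (x t) (D t) 0 i) a b t0.
  move=> H; have [|d1 d10 {}H] := H _ d d0.
    move=> [[[i|j]|j]|i] /= e e0; [|exact: cx|exact: cD|].
      by exists e.
    by exists 1 => // u _ _; rewrite subrr normr0.
  by exists d1 => // t tab /(H t tab); rewrite !sum_coord4.
exists (1 + `|g|), (Num.min d1 (d / 2)); split; first by rewrite addr_ge0.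
  by rewrite lt_min d10 divr_gt0.
move=> t y1 y2 tab; rewrite !lt_min => /andP[td1 _] /andP[_ y1d] /andP[_ y2d].
have := strict (t, x t, D t, y2) (y1 - y2).
have -> : (t, x t, D t, y2) + (y1 - y2) *: (0, 0, 0, 1) = (t, x t, D t, y1).
  congr (_, _, _, _); rewrite /= ?scaler0 ?addr0//.
  by rewrite /GRing.scale/= mulr1 addrC subrK.
have y12 : `|y1 - y2| < d.
  have := ler_distD (z1 t0) y1 y2; rewrite (distrC (z1 t0)); lra.
have pd : `|(t, x t, D t, y2) - (t0, x t0, D t0, z1 t0)| < d.
  have := pnear t tab td1; rewrite !prod_normE/= !gt_max.
  move=> /andP[-> _] /=; lra.
move=> /(_ pd y12) H.
have := ler_normD (L (t, x t, D t, y1) - L (t, x t, D t, y2) - (y1 - y2) * g) ((y1 - y2) * g).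
rewrite subrK normrM; lra.
Qed.

Theorem theorem4p1 (R : realType) (n : nat) (a b : R) (al : 'I_n -> R)
  (L : R * 'rV[R]_n * 'rV[R]_n * R -> R)
  (x : R -> 'rV[R]_n) (z : R -> R) (za : R)
  (h : 'I_n -> R * 'rV[R]_n * R -> R) (eps : R)
  (zbar : R -> R -> R) :
  a < b ->
  (forall j, 0 < al j < 1) ->
  (* L : [a,b] x R^(2n+1) -> R is C^1 *)
  (exists U, [set p | a <= p.1.1.1 <= b] `<=` U /\ C1_open U L) ->
  (* x in C^1([a,b],R^n) and its Caputo derivative is C^1([a,b],R^n) *)
  (forall j, C1_on a b (fun t => x t ord0 j)) ->
  (forall j, C1_on a b (caputo a b (al j) (fun t => x t ord0 j))) ->
  let Dx (y : R -> 'rV[R]_n) (t : R) : 'rV[R]_n :=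
    \row_j caputo a b (al j) (fun u => y u ord0 j) t in
  (* z = z[x; .] solves dz/dt = L(t, x, D x, z), z(a) = za *)
  z a = za ->
  (forall t, a <= t <= b -> has_deriv_on a b z t (L (t, x t, Dx x t, z t))) ->
  let lam (t : R) : R :=
    expR (- \int[lebesgue_measure]_(tau in `[a, t])
             ('D_((0, 0, 0, 1)) L (tau, x tau, Dx x tau, z tau))) in
  let dLdx (j : 'I_n) (t : R) : R :=
    'D_((0, erow R j, 0, 0)) L (t, x t, Dx x t, z t) in
  let dLdDx (j : 'I_n) (t : R) : R :=
    'D_((0, 0, erow R j, 0)) L (t, x t, Dx x t, z t) in
  let P (j : 'I_n) (t : R) : R := lam t * dLdDx j t in
  (* the right RL derivatives of lam * dL/dD x_j exist and are continuous *)
  (forall j t, a <= t <= b -> rl_right_exists a b (al j) (P j) t) ->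
  (forall j, {within `[a, b], continuous (rl_right a b (al j) (P j))}) ->
  (* the family of transformations h_j(t, x, s), of class C^2, h_j(t,x,0) = x_j *)
  0 < eps ->
  (forall j, exists U, [set p | a <= p.1.1 <= b /\ - eps < p.2 < eps] `<=` U /\
                       C2_open U (h j)) ->
  (forall j t X, a <= t <= b -> h j (t, X, 0) = X ord0 j) ->
  let xi (j : 'I_n) (t : R) (X : 'rV[R]_n) : R := 'D_((0, 0, 1)) (h j) (t, X, 0) in
  let xs (s t : R) : 'rV[R]_n := x t + s *: \row_j xi j t (x t) in
  (* zbar s = zbar[x + s xi; .] solves the same equation with x replaced by x + s xi *)
  (forall s, - eps < s < eps ->
     zbar s a = za /\
     forall t, a <= t <= b ->
       has_deriv_on a b (zbar s) t (L (t, xs s t, Dx (xs s) t, zbar s t))) ->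
  (* invariance: theta(t) = d/ds zbar[x + s xi; t] |_(s=0) = 0 *)
  (forall t, a <= t <= b ->
     derivable (fun s => zbar s t) 0 1 /\ derive1 (fun s => zbar s t) 0 = 0) ->
  (* x satisfies the generalized fractional Euler--Lagrange equations *)
  (forall j t, a <= t <= b -> lam t * dLdx j t + rl_right a b (al j) (P j) t = 0) ->
  forall t, a <= t <= b ->
    \sum_(j < n) Dpair a b (al j) (P j) (fun u => xi j u (x u)) t = 0.
Proof.
move=> ab al01 [U [LU C1L]] C1x C1Dx Dx za_ zL lam dLdx dLdDx P _ _ eps0 C2h _ xi xs zbarL
  theta0 EL t0 t0ab.
pose y u : 'rV[R]_n := \row_j xi j u (x u).
(* One derivative of [h j] is spent on [xi]; class [C^2] leaves a [C^1] function, whose Caputo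
   derivative is then continuous. *)
have C1y j : C1_on a b (fun u => xi j u (x u)).
  have [W [hW [_ /(_ (0, 0, 1)) C1xi]]] := C2h j.
  apply: C1_on_comp ab C1xi _ C1x => t tab; apply: hW; split => //=.
  by rewrite oppr_lt0 eps0.
pose Dy u : 'rV[R]_n := \row_j caputo a b (al j) (fun u => xi j u (x u)) u.
(* The perturbed argument of [L] is thus exactly affine in [s], as [C1_open_linearization]
   requires. *)
have DxsE s t : a <= t <= b -> Dx (xs s) t = Dx x t + s *: Dy t.
  move=> tab; apply/rowP => j; rewrite !mxE.
  rewrite -(caputo_linear _ _ _ _ _ _ _ ab (al01 j) (C1x j) (C1y j) tab).
  by congr (caputo _ _ _ _ t); apply/funext => u; rewrite !mxE.
have ncx j t : a <= t <= b -> cont_on a b (fun u => x u ord0 j) t.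
  exact: C1_on_cont.
have ncDx j t : a <= t <= b -> cont_on a b (fun u => Dx x u ord0 j) t.
  rewrite (_ : (fun u => _) = caputo a b (al j) (fun u => x u ord0 j)).
    exact: C1_on_cont.
  by apply/funext => u; rewrite mxE.
have ncy j t : a <= t <= b -> cont_on a b (fun u => y u ord0 j) t.
  rewrite (_ : (fun u => _) = (fun u => xi j u (x u))); first exact: C1_on_cont.
  by apply/funext => u; rewrite mxE.
have ncDy j t : a <= t <= b -> cont_on a b (fun u => Dy u ord0 j) t.
  rewrite (_ : (fun u => _) = caputo a b (al j) (fun u => xi j u (x u))).
    by move=> tab; apply: (proj1 (within_itv_continuousP _ _ _)) => //; exact: caputo_continuous.
  by apply/funext => u; rewrite mxE.
(* The difference quotients in [theta0] start from [zbar 0], whereas [d] is measured from [z]. *)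
have zbar0 t : a <= t <= b -> zbar 0 t = z t.
  have [|z0a z0L] := zbarL 0; first by rewrite oppr_lt0 eps0.
  apply: (ode_unique_C1 _ _ L U x (Dx x) _ _ ab C1L LU ncx ncDx _ _ zL).
    by rewrite z0a za_.
  move=> u uab; have := z0L u uab; rewrite DxsE// /xs.
  by rewrite !scale0r !addr0.
pose d s t := zbar s t + -1 * z t.
have zbarE s t : zbar s t = z t + d s t by rewrite /d; ring.
pose G := \sum_j (y t0 ord0 j * dLdx j t0 + Dy t0 ord0 j * dLdDx j t0).
pose dLdz := 'D_((0, 0, 0, 1)) L (t0, x t0, Dx x t0, z t0).
have G0 : G = 0.
  pose d' s t := L (t, xs s t, Dx (xs s) t, zbar s t) + -1 * L (t, x t, Dx x t, z t).
  apply: (@linearized_slope_eq0 R a b eps d d' t0 G (`|dLdz| + 1)) => //.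
  - move=> s seps t tab; apply: has_deriv_onD; first exact: (zbarL s seps).2.
    by apply: has_deriv_onZ; exact: zL.
  - move=> e e0.
    have Up : U (t0, x t0, Dx x t0, z t0) by exact: LU.
    have ncz : cont_on a b z t0 by apply: has_deriv_on_cont; exact: zL.
    have [dl dl0 H] := @C1_open_linearization R n a b t0 L U x (Dx x) y Dy z C1L
      Up (fun j => ncx j t0 t0ab) (fun j => ncDx j t0 t0ab)
      (fun j => ncy j t0 t0ab) (fun j => ncDy j t0 t0ab) ncz e e0.
    exists dl => // s t tab tt0 sdl ddl; rewrite /d' mulN1r DxsE// zbarE.
    exact: H.
  - move=> t tab eta eta0; have [dz dz0] := theta0 t tab.
    have /cvgrPdist_le/(_ eta eta0) : (fun s => s^-1 *: (zbar s t - zbar 0 t)) @ 0^' --> 0.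
      have -> : (fun s => s^-1 *: (zbar s t - zbar 0 t)) =
          (fun s : R => s^-1 *: (zbar (s *: 1 + 0) t - zbar 0 t)).
        by apply/funext => s; rewrite addr0 [s *: 1]mulr1.
      by rewrite -[X in _ --> X]dz0 derive1E; exact: dz.
    move=> [dl /= dl0 H]; exists dl => // s sdl.
    have -> : d s t = zbar s t - zbar 0 t by rewrite zbar0// /d mulN1r.
    (* The punctured limit says nothing at [s = 0], where the difference vanishes by itself. *)
    have [->|s0] := eqVneq s 0; first by rewrite subrr !normr0 mulr0.
    have := H s; rewrite /= !sub0r !normrN => /(_ sdl s0).
    by rewrite normrZ normfV mulrC ler_pdivrMr// normr_gt0.
have -> : \sum_(j < n) Dpair a b (al j) (P j) (fun u => xi j u (x u)) t0 = lam t0 * G.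
  rewrite /G mulr_sumr; apply: eq_bigr => j _.
  have := EL j t0 t0ab => /(canRL (addKr _)) ELj.
  by rewrite /Dpair ELj !mxE /P; ring.
by rewrite G0 mulr0.
Qed.
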